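(* Let $m,n$ be nonnegative integers. Then: \begin{enumerate} \item $L_{m,n,1}=\dfrac{m^3}{36}+\dfrac{7m^2}{24}+\dfrac{11m}{12}+1-\dfrac{(m \bmod 2)}{8}-\dfrac{(m \bmod 3)}{9}$. \item For $(m,n)=(2,0),(1,2),(2,1),(1,3),(2,2),(1,4),(3,0)$ respectively, the numbers $L_{m,n,2m+n-2}$ (MDS codes with code distance $d=3$) are $2,1,2,1,0,0,0$, and the numbers $L_{m,n,2m+n-3}$ (MDS codes with code distance $d=4$) are $4,2,2,1,1,0,0$. \item If $2m+n=6$, then $L_{m,n,2}=0$. \item If $2m+n>6$ and $d$ is an integer with $2<d<2m+n$, then $L_{m,n,k}=0$ where $k=2m+n-d+1$; that is, $D(m,n)$ contains no MDS code with code distance $d$. \end{enumerate}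
   Context: The Shrikhande graph $\mathrm{Sh}$ is the Cayley graph on the group $\mathbb{Z}_4^2$ (elements written as two-digit strings $ab$, $a,b\in\mathbb{Z}_4$) with connection set $\{01,03,10,30,11,33\}$: two vertices are adjacent iff their difference lies in this set. $K$ denotes the complete graph $K_4$ on vertex set $\mathbb{Z}_4$. For nonnegative integers $m,n$, $D(m,n)$ is the Cartesian product of $m$ copies of $\mathrm{Sh}$ and $n$ copies of $K$ (for $m>0$ it is a Doob graph; $D(0,n)$ is the Hamming graph $H(n,4)$). Its vertices are $(s_1,\dots,s_m;h_1,\dots,h_n)$ with $s_i\in\mathbb{Z}_4^2$, $h_j\in\mathbb{Z}_4$, and the graph distance is $d(c,c')=\sum_i d_{\mathrm{Sh}}(s_i,s_i')+\sum_j d_K(h_j,h_j')$. A code is a subset of the vertex set; its code distance is the minimum distance between distinct codewords. For an integer $k\ge 1$, an MDS code with parameters $(m+n,4^k,d)$ is a code $C$ in $D(m,n)$ with $|C|=4^k$ and code distance $d=2m+n-k+1$. Codes $C,C'$ in $D(m,n)$ are equivalent if there are automorphisms $\theta_1,\dots,\theta_m$ of $\mathrm{Sh}$, permutations $\sigma_1,\dots,\sigma_n$ of $\mathbb{Z}_4$, and permutations $\pi\in S_m$, $\rho\in S_n$ such that $C'=\{(\theta_1(s_{\pi(1)}),\dots,\theta_m(s_{\pi(m)});\sigma_1(h_{\rho(1)}),\dots,\sigma_n(h_{\rho(n)})):(s_1,\dots,s_m;h_1,\dots,h_n)\in C\}$. $L_{m,n,k}$ denotes the number of equivalence classes of MDS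 codes in $D(m,n)$ with $4^k$ codewords (i.e. with code distance $2m+n-k+1$).
   Formalization: Part 1 is stated for (m,n) ≠ (0,0): the graph D(0,0) has a single vertex and so no code with 4 codewords, hence L_{0,0,1} = 0, while the formula gives 1. *)

(* Defs.v *)
From HB Require Import structures.
From mathcomp Require Import all_boot all_order all_algebra all_fingroup.

Set Implicit Arguments.
Unset Strict Implicit.
Unset Printing Implicit Defensive.

Import GRing.Theory.

(* The length of a shortest path from x to y, or #|T| if there is none. *)
Definition gdist (T : finType) (e : rel T) (x y : T) : nat :=
  find (fun l => [exists p : l.-tuple T, path e x p && (last x p == y)])
       (iota 0 #|T|).

Definition shV : finType := ('Z_4 * 'Z_4)%type.

Definition sh_conn : seq ('Z_4 * 'Z_4) :=
  [:: (0, 1); (0, 3); (1, 0); (3, 0); (1, 1); (3, 3)]%R.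

Definition sh_adj : rel shV :=
  fun u v => ((u : 'Z_4 * 'Z_4) - (v : 'Z_4 * 'Z_4))%R \in sh_conn.

Definition kV : finType := 'Z_4.

Definition k_adj : rel kV := fun a b => a != b.

Definition doobV (m n : nat) : finType :=
  ({ffun 'I_m -> shV} * {ffun 'I_n -> kV})%type.

(* Cartesian product of graphs: adjacent vertices differ in exactly one
   coordinate, where they are adjacent in the corresponding factor. *)
Definition doob_adj (m n : nat) : rel (doobV m n) := fun c c' =>
  [exists i : 'I_m, [&& sh_adj (c.1 i) (c'.1 i),
      [forall j, (j != i) ==> (c.1 j == c'.1 j)] & c.2 == c'.2]] ||
  [exists i : 'I_n, [&& k_adj (c.2 i) (c'.2 i),
      [forall j, (j != i) ==> (c.2 j == c'.2 j)] & c.1 == c'.1]].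

(* Equal to the sum of the distances in the factors: see doob_distE. *)
Definition doob_dist (m n : nat) : doobV m n -> doobV m n -> nat :=
  gdist (@doob_adj m n).

Definition has_code_dist (m n : nat) (C : {set doobV m n}) (d : nat) : bool :=
  [exists c in C, exists c' in C, (c != c') && (doob_dist c c' == d)] &&
  [forall c in C, forall c' in C, (c != c') ==> (d <= doob_dist c c')].

(* The subtraction truncates only when k > 2m + n, and then no code has
   4 ^ k codewords, since there are 4 ^ (2m + n) vertices. *)
Definition mds_code (m n k : nat) (C : {set doobV m n}) : bool :=
  (#|C| == 4 ^ k) && has_code_dist C (2 * m + n - k + 1).

Definition sh_aut (theta : {perm shV}) : bool :=
  [forall x, forall y, sh_adj (theta x) (theta y) == sh_adj x y].

Definition code_map (m n : nat)
    (theta : {ffun 'I_m -> {perm shV}}) (sigma : {ffun 'I_n -> {perm kV}})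
    (pi : 'S_m) (rho : 'S_n) (c : doobV m n) : doobV m n :=
  ([ffun i => theta i (c.1 (pi i))], [ffun j => sigma j (c.2 (rho j))]).

Definition code_equiv (m n : nat) (C C' : {set doobV m n}) : bool :=
  [exists theta : {ffun 'I_m -> {perm shV}},
   exists sigma : {ffun 'I_n -> {perm kV}},
   exists pi : 'S_m, exists rho : 'S_n,
     [forall i, sh_aut (theta i)] &&
     (C' == [set code_map theta sigma pi rho c | c in C])].

(* L m n k is the number of equivalence classes of MDS codes with 4 ^ k
   codewords in D(m, n); code_equiv is an equivalence relation by
   code_equiv_refl, code_equiv_sym and code_equiv_trans below. *)
Definition L (m n k : nat) : nat :=
  #|equivalence_partition (@code_equiv m n)
      [set C : {set doobV m n} | mds_code k C]|.

Section GraphDistance.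
Variables (T : finType) (e : rel T).

Lemma gdist_le x y p : path e x p -> last x p = y -> gdist e x y <= size p.
Proof.
move=> ep lp; rewrite leqNgt; apply/negP => lt.
have := before_find 0 lt.
have sz : size p < #|T|.
  by apply: leq_trans lt _; rewrite -[leqRHS](size_iota 0); apply: find_size.
rewrite nth_iota // add0n => /existsP[].
by exists (in_tuple p); rewrite /= ep lp eqxx.
Qed.

Lemma gdist_path x y : connect e x y ->
  exists p, [/\ path e x p, last x p = y & size p = gdist e x y].
Proof.
move=> /connectP[p0 ep0 ->]; case/shortenP: ep0 => p ep up _.
set y0 := last x p.
have sz : size p < #|T|.
  by have := card_uniqP up; rewrite /= => <-; apply: max_card.
have lt : gdist e x y0 < size (iota 0 #|T|).
  by rewrite size_iota; apply: leq_ltn_trans sz; apply: gdist_le.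
have := nth_find 0; rewrite /gdist -has_find in lt * => /(_ _ _ lt).
rewrite nth_iota; last by rewrite has_find size_iota in lt.
rewrite add0n => /existsP[q /andP[eq /eqP lq]].
by exists q; rewrite size_tuple.
Qed.

Lemma gdistxx x : gdist e x x = 0.
Proof. by apply/eqP; rewrite -leqn0; apply: (@gdist_le x x [::]). Qed.

Lemma gdist_charact (y : T) (f : T -> nat) :
  f y = 0 -> (forall x, f x = 0 -> x = y) ->
  (forall x z, e x z -> f x <= (f z).+1) ->
  (forall x s, f x = s.+1 -> exists2 z, e x z & f z = s) ->
  forall x, gdist e x y = f x.
Proof.
move=> fy f0 fle fS x.
have [p [ep lp sp]] : exists p, [/\ path e x p, last x p = y & size p = f x].
  move: {2}(f x) (erefl (f x)) => s; elim: s x => [|s IH] x fx.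
    by exists [::]; rewrite fx (f0 _ fx).
  have [z exz fz] := fS _ _ fx; have [p [ep lp sp]] := IH _ fz.
  by exists (z :: p); rewrite /= exz ep lp sp fz fx.
apply/eqP; rewrite eqn_leq -{1}sp (gdist_le ep lp) /=.
have cxy : connect e x y by apply/connectP; exists p.
have [q [eq lq <-]] := gdist_path cxy.
elim: q x eq lq {p ep lp sp cxy} => [x _ /= ->|z q IH x /= /andP[exz eq] lq].
  by rewrite fy.
by apply: leq_trans (fle _ _ exz) _; rewrite ltnS; apply: IH.
Qed.

Hypothesis conn : forall x y, connect e x y.

Lemma gdist0 x y : gdist e x y = 0 -> x = y.
Proof.
by have [[|z p] [_ /= lp <-]] := gdist_path (conn x y).
Qed.

Lemma gdist_step x y z : e x z -> gdist e x y <= (gdist e z y).+1.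
Proof.
move=> exz; have [p [ep lp <-]] := gdist_path (conn z y).
by apply: (@gdist_le _ _ (z :: p)); rewrite //= exz.
Qed.

Lemma gdistS x y s : gdist e x y = s.+1 ->
  exists2 z, e x z & gdist e z y = s.
Proof.
move=> dxy; have [p [ep lp]] := gdist_path (conn x y).
rewrite dxy; case: p ep lp => // z p /= /andP[exz ep] lp [sp].
exists z => //; apply/eqP; rewrite eqn_leq -{1}sp (gdist_le ep lp) /=.
by rewrite -ltnS -dxy gdist_step.
Qed.

End GraphDistance.

Lemma k_connect x y : connect k_adj x y.
Proof.
by have [->|xy] := eqVneq x y; [apply: connect0 | apply: connect1].
Qed.

Lemma sh_connect x y : connect sh_adj x y.
Proof.
have st (u : 'Z_4 * 'Z_4) w k : (w \in sh_conn) ->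
    connect sh_adj u (u - w *+ k)%R.
  move=> hw; elim: k => [|k IH]; first by rewrite mulr0n subr0 connect0.
  apply: connect_trans IH _; apply: connect1.
  have -> : (u - w *+ k.+1 = u - w *+ k - w)%R by rewrite mulrSr opprD addrA.
  by rewrite /sh_adj subKr.
case: x y => [a b] [a' b'].
have := st (a, b) (0, 1)%R (val (b - b')%R) isT.
have := st (a, b') (1, 0)%R (val (a - a')%R) isT.
have sub1 (r t : 'Z_4) : (r - 1 *+ val (r - t) = t)%R.
  by rewrite (natr_Zp (r - t)%R) subKr.
have E1 : ((a, b') - (1, 0) *+ val (a - a'))%R = (a', b') :> 'Z_4 * 'Z_4.
  apply: injective_projections; rewrite raddfB raddfMn; first exact: sub1.
  by rewrite [X in (X *+ _)%R](_ : _ = 0%R) // mul0rn subr0.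
have E2 : ((a, b) - (0, 1) *+ val (b - b'))%R = (a, b') :> 'Z_4 * 'Z_4.
  apply: injective_projections; rewrite raddfB raddfMn; last exact: sub1.
  by rewrite [X in (X *+ _)%R](_ : _ = 0%R) // mul0rn subr0.
by rewrite E1 E2 => h1 h2; apply: connect_trans h2 h1.
Qed.

Lemma sum_gdist_move (n : nat) (T : finType) (e : rel T)
    (x z y : {ffun 'I_n -> T}) i :
  (forall j, j != i -> x j = z j) ->
  \sum_j gdist e (x j) (y j) + gdist e (z i) (y i) =
  \sum_j gdist e (z j) (y j) + gdist e (x i) (y i).
Proof.
move=> xz; rewrite (bigD1 i) //= [in RHS](bigD1 i) //= addnAC [RHS]addnAC.
by rewrite [gdist e (x i) _ + _]addnC; congr (_ + _); apply: eq_bigr => j /xz ->.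
Qed.

Lemma sum_gdistS (n : nat) (T : finType) (e : rel T)
    (x y : {ffun 'I_n -> T}) s :
  (forall a b, connect e a b) ->
  \sum_j gdist e (x j) (y j) = s.+1 ->
  exists i, exists2 z : {ffun 'I_n -> T},
    e (x i) (z i) /\ (forall j, j != i -> x j = z j) &
    \sum_j gdist e (z j) (y j) = s.
Proof.
move=> conn sx.
have [i di] : exists i, gdist e (x i) (y i) != 0.
  apply/existsP; apply: contra_eqT sx => /existsPn h.
  by rewrite big1 // => i _; apply/eqP; have := h i; rewrite negbK.
move: di; case dx: (gdist e (x i) (y i)) => [//|t] _.
have [w exw dw] := gdistS conn dx.
pose z := [ffun j => if j == i then w else x j].
have zx j : j != i -> x j = z j by rewrite ffunE => /negPf ->.
exists i, z; first by split=> //; rewrite ffunE eqxx.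
have := sum_gdist_move e y zx.
by rewrite sx dx ffunE eqxx dw addnS addSn => -[] /addIn.
Qed.

Lemma doob_distE (m n : nat) (c c' : doobV m n) :
  doob_dist c c' = \sum_(i < m) gdist sh_adj (c.1 i) (c'.1 i) +
                   \sum_(j < n) gdist k_adj (c.2 j) (c'.2 j).
Proof.
rewrite /doob_dist; move: c; apply: gdist_charact.
- by rewrite !big1 // => i _; apply: gdistxx.
- move=> x /eqP; rewrite addn_eq0 !sum_nat_eq0 => /andP[/forallP h1 /forallP h2].
  rewrite [x]surjective_pairing [c']surjective_pairing; congr pair.
    by apply/ffunP => i; apply: (gdist0 sh_connect); apply/eqP/h1.
  by apply/ffunP => i; apply: (gdist0 k_connect); apply/eqP/h2.
- move=> x z /orP[] /existsP[i /and3P[exz /forallP h /eqP <-]].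
    have xz j : j != i -> x.1 j = z.1 j by move=> ji; apply/eqP/(implyP (h j)).
    rewrite -addSn leq_add2r -(leq_add2r (gdist sh_adj (z.1 i) (c'.1 i))).
    rewrite (sum_gdist_move sh_adj c'.1 xz) addSnnS leq_add2l.
    exact: (gdist_step sh_connect).
  have xz j : j != i -> x.2 j = z.2 j by move=> ji; apply/eqP/(implyP (h j)).
  rewrite -addnS leq_add2l -(leq_add2r (gdist k_adj (z.2 i) (c'.2 i))).
  rewrite (sum_gdist_move k_adj c'.2 xz) addSnnS leq_add2l.
  exact: (gdist_step k_connect).
move=> x s.
case d1: (\sum_(i < m) _) => [|t1]; last first.
  rewrite addSn => -[<-].
  have [i [z [exz xz] dz]] := sum_gdistS sh_connect d1.
  exists (z, x.2); last by rewrite /= dz.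
  apply/orP; left; apply/existsP; exists i; rewrite /= exz eqxx andbT.
  by apply/forallP => j; apply/implyP => /xz ->.
rewrite add0n => d2.
have [i [z [exz xz] dz]] := sum_gdistS k_connect d2.
exists (x.1, z); last by rewrite /= dz d1.
apply/orP; right; apply/existsP; exists i; rewrite /= exz eqxx andbT.
by apply/forallP => j; apply/implyP => /xz ->.
Qed.

Lemma sh_autP (theta : {perm shV}) :
  reflect (forall x y, sh_adj (theta x) (theta y) = sh_adj x y) (sh_aut theta).
Proof.
apply: (iffP forallP) => [h x y|h x]; first exact/eqP/(forallP (h x)).
by apply/forallP => y; rewrite h.
Qed.

Lemma code_equivP (m n : nat) (C C' : {set doobV m n}) :
  reflect (exists (theta : {ffun 'I_m -> {perm shV}})
                  (sigma : {ffun 'I_n -> {perm kV}}) (pi : 'S_m) (rho : 'S_n),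
             (forall i, sh_aut (theta i)) /\
             C' = [set code_map theta sigma pi rho c | c in C])
          (code_equiv C C').
Proof.
apply: (iffP existsP) => [[t /existsP[s /existsP[p /existsP[r]]]]|].
  by case/andP => /forallP ht /eqP ->; exists t, s, p, r.
move=> [t [s [p [r [ht ->]]]]]; exists t; apply/existsP; exists s.
apply/existsP; exists p; apply/existsP; exists r.
by rewrite eqxx andbT; apply/forallP.
Qed.

Lemma code_equiv_refl (m n : nat) : reflexive (@code_equiv m n).
Proof.
move=> C; apply/code_equivP.
exists [ffun => 1%g], [ffun => 1%g], 1%g, 1%g; split=> [i|].
  by rewrite ffunE; apply/sh_autP => x y; rewrite !perm1.
rewrite -[LHS]imset_id; apply: eq_imset => -[a b] /=.
by rewrite /code_map; congr pair; apply/ffunP => i; rewrite !ffunE !perm1.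
Qed.

Lemma code_equiv_trans (m n : nat) : transitive (@code_equiv m n).
Proof.
move=> C2 C1 C3 /code_equivP[t [s [p [r [ht ->]]]]].
move=> /code_equivP[t' [s' [p' [r' [ht' ->]]]]]; apply/code_equivP.
exists [ffun i => t (p' i) * t' i]%g, [ffun i => s (r' i) * s' i]%g.
exists (p' * p)%g, (r' * r)%g; split=> [i|].
  by rewrite ffunE; apply/sh_autP => x y; rewrite !permM !(sh_autP _ _).
rewrite -imset_comp; apply: eq_imset => -[a b] /=.
by rewrite /code_map; congr pair; apply/ffunP => i; rewrite !ffunE !permM.
Qed.

Lemma code_equiv_sym (m n : nat) : symmetric (@code_equiv m n).
Proof.
suff h C C' : @code_equiv m n C C' -> code_equiv C' C.
  by move=> C C'; apply/idP/idP; apply: h.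
move=> /code_equivP[t [s [p [r [ht ->]]]]]; apply/code_equivP.
exists [ffun i => (t (p^-1 i))^-1]%g, [ffun i => (s (r^-1 i))^-1]%g.
exists p^-1%g, r^-1%g; split=> [i|].
  rewrite ffunE; apply/sh_autP => x y.
  by rewrite -(sh_autP _ (ht (p^-1%g i))) !permKV.
rewrite -imset_comp -[LHS]imset_id; apply: eq_imset => -[a b] /=.
rewrite /code_map; congr pair; apply/ffunP => i;
by rewrite !ffunE !permKV permK.
Qed.

(* Main.v *)
(** For every set A of words, 4 sum_{x, y in A} d(x, y) <= 3 (2m + n) |A|^2: the
    distance matrices of Sh and K are constant matrices minus positive
    semidefinite ones.  This Plotkin bound, the packing bound for d = 3,
    shortening and puncturing exclude every code asserted not to exist, except
    those with d = 4 in D(1,4) and D(3,0), which an exhaustive search excludes;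
    for k = 3 and n = 0 the bound is applied to the words whose first coordinate
    lies on an edge of Sh.

    For k = 1 a code is four words at maximal distance.  Two 4-tuples of
    pairwise non-adjacent vertices of Sh are related by an automorphism exactly
    when they have the same one of four types, three of which are permuted by
    relabelling the words as the three splittings of a 4-set into pairs, while
    the fourth is fixed.  The class of a code is thus the sorted triple of
    numbers of coordinates of the three types, and these triples are counted.

    For k = 2 and d = 2m + n - 1 a code is a graph over its first coordinate,
    and the words over a triangle of Sh can be normalised; a search then finds
    at most 84 codes, each equivalent to a representative.  For k = 3 the words
    with last coordinate 0 form such a representative, and extending it is
    again a search.  Representatives are told apart by counting pairs of words
    related in every Sh-coordinate by an Aut(Sh)-invariant relation. *)

Require Import Defs.
From mathcomp Require Import all_boot all_order all_algebra.
From mathcomp Require Import all_fingroup zify lra.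

Set Implicit Arguments.
Unset Strict Implicit.
Unset Printing Implicit Defensive.

Import GRing.Theory.

(** * Computable encoding of the Shrikhande graph *)

(** The vertex (a, b) is encoded as 4 a + b. The left side encodes the difference of two vertices,
    the 4 added in each coordinate keeping the subtraction of naturals exact; the list encodes the
    connection set. *)
Definition adjn (x y : nat) : bool :=
  4 * ((x %/ 4 + 4 - y %/ 4) %% 4) + (x %% 4 + 4 - y %% 4) %% 4
    \in [:: 1; 3; 4; 12; 5; 15].

(** Distinct non-adjacent vertices get 2 because Sh has diameter 2, which [gdist_sh] confirms. The
    table is stored in normal form, so a distance costs only a lookup. *)
Definition dsh_table : seq (seq nat) :=
  Eval vm_compute in
  [seq [seq if x == y then 0 else if adjn x y then 1 else 2 | y <- iota 0 16]
  | x <- iota 0 16].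

Definition dsh (x y : nat) : nat := nth 0 (nth [::] dsh_table x) y.

Definition encS (u : shV) : nat := 4 * (u.1 : 'Z_4) + (u.2 : 'Z_4).
Definition decS (k : nat) : shV := (inZp (k %/ 4), inZp (k %% 4)).

Lemma encS_lt u : encS u < 16.
Proof.
case: u => [[a ha] [b hb]]; rewrite /encS /=; have := ha; have := hb.
by rewrite /Zp_trunc /=; lia.
Qed.

Lemma encSK : cancel encS decS.
Proof.
case=> [[a ha] [b hb]]; rewrite /encS /decS /=.
have := ha; have := hb; rewrite /Zp_trunc /= => hb' ha'.
congr pair; apply: val_inj => /=.
  by rewrite mulnC divnMDl // divn_small // addn0 modn_small.
by rewrite mulnC modnMDl !modn_small.
Qed.

Lemma decSK k : k < 16 -> encS (decS k) = k.
Proof.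
move=> hk; rewrite /encS /decS /=.
rewrite [_ %% 4 %% _]modn_mod [k %/ 4 %% _]modn_small; last by rewrite /Zp_trunc /=; lia.
by rewrite mulnC -divn_eq.
Qed.

Lemma encS_inj : injective encS.
Proof. exact: can_inj encSK. Qed.

(** Statements about all vertices are reduced through this to finite tests that [vm_compute]
    decides. *)
Lemma forall_sh (P : nat -> bool) : all P (iota 0 16) -> forall u, P (encS u).
Proof. by move=> /allP h u; apply: h; rewrite mem_iota encS_lt. Qed.

Lemma forall_sh2 (P : nat -> nat -> bool) :
  all (fun x => all (P x) (iota 0 16)) (iota 0 16) ->
  forall u v, P (encS u) (encS v).
Proof.
by move=> h u v; apply: (forall_sh (P := P (encS u))); apply: (forall_sh h u).
Qed.

Lemma sh_adjE u v : sh_adj u v = adjn (encS u) (encS v).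
Proof.
have h : all (fun x => all (fun y => sh_adj (decS x) (decS y) == adjn x y)
    (iota 0 16)) (iota 0 16) by vm_compute.
by have /eqP := forall_sh2 h u v; rewrite !encSK.
Qed.

(** Paths are not enumerated: [gdist_charact] reduces the claim to local properties of the table,
    namely its zeros, the bound along an edge and the existence of a neighbour one step closer. *)
Lemma gdist_sh u v : gdist sh_adj u v = dsh (encS u) (encS v).
Proof.
move: u; apply: gdist_charact.
- apply/eqP; move: v; apply: (@forall_sh (fun x => dsh x x == 0)).
  by vm_compute.
- move=> u /eqP h; apply: encS_inj; apply/eqP; move: h; apply/implyP.
  apply: (@forall_sh2 (fun x y => (dsh x y == 0) ==> (x == y))).
  by vm_compute.
- move=> u w; rewrite sh_adjE; apply/implyP.
  have h : all (fun x => all (fun z => adjn x z ==>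
    all (fun y => dsh x y <= (dsh z y).+1) (iota 0 16)) (iota 0 16)) (iota 0 16).
    by vm_compute.
  have /implyP h2 := forall_sh2 h u w; apply/implyP => /h2 /allP; apply.
  by rewrite mem_iota encS_lt.
move=> u s dus.
have h : all (fun x => all (fun y => (dsh x y == 0) ||
    has (fun z => adjn x z && ((dsh z y).+1 == dsh x y)) (iota 0 16))
    (iota 0 16)) (iota 0 16) by vm_compute.
have := forall_sh2 h u v; rewrite dus [_ == 0]/= orFb => /hasP[z].
rewrite mem_iota => /= hz /andP[az /eqP[<-]].
by exists (decS z); rewrite ?sh_adjE decSK.
Qed.

Lemma gdist_k a b : gdist k_adj a b = (a != b).
Proof.
move: a; apply: gdist_charact => [|a|a c|a s].
- by rewrite eqxx.
- by case: eqVneq.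
- by case: (a != b).
by case: eqVneq => // ab [<-]; exists b; rewrite ?eqxx.
Qed.

(** * Words and codes as lists of numbers *)

(** A word lists its m Sh-coordinates first and then its K-coordinates; the counter m runs down to
    mark where the second kind starts. *)
Fixpoint wdist (m : nat) (w v : seq nat) {struct w} : nat :=
  match w, v with
  | x :: w', y :: v' =>
    match m with
    | m'.+1 => dsh x y + wdist m' w' v'
    | 0 => (if eqn x y then 0 else 1) + wdist 0 w' v'
    end
  | _, _ => 0
  end.

Lemma wdist_cat m (a a' b b' : seq nat) : size a = m -> size a' = m ->
  wdist m (a ++ b) (a' ++ b') = wdist m a a' + wdist 0 b b'.
Proof.
move=> <-; elim: a a' => [|x a IH] [|x' a'] //= [sz].
by rewrite IH // addnA.
Qed.

Lemma wdist_sh m (I : Type) (s : seq I) (f g : I -> nat) : size s = m ->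
  wdist m [seq f i | i <- s] [seq g i | i <- s] =
  \sum_(i <- s) dsh (f i) (g i).
Proof.
by move=> <-; elim: s => [|i s IH]; rewrite ?big_nil // big_cons /= IH.
Qed.

Lemma wdist_k (I : Type) (s : seq I) (f g : I -> nat) :
  wdist 0 [seq f i | i <- s] [seq g i | i <- s] =
  \sum_(i <- s) (f i != g i).
Proof.
elim: s => [|i s IH]; first by rewrite big_nil.
by rewrite big_cons /= IH eqnE; case: eqP.
Qed.

Section Encoding.
Variables m n : nat.
Implicit Types c : doobV m n.

Definition enc c : seq nat :=
  [seq encS (c.1 i) | i <- enum 'I_m] ++
  [seq nat_of_ord (c.2 j : 'Z_4) | j <- enum 'I_n].

Definition decW (w : seq nat) : doobV m n :=
  ([ffun i : 'I_m => decS (nth 0 w i)],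
   [ffun j : 'I_n => (inZp (nth 0 w (m + j)) : 'Z_4)]).

Lemma doob_dist_enc c c' : doob_dist c c' = wdist m (enc c) (enc c').
Proof.
have sz (x : doobV m n) : size [seq encS (x.1 i) | i <- enum 'I_m] = m.
  by rewrite size_map size_enum_ord.
rewrite doob_distE /enc (wdist_cat _ _ (sz c) (sz c')).
rewrite (wdist_sh _ _ (size_enum_ord m)) wdist_k.
rewrite [X in _ = X + _]big_enum [X in _ = _ + X]big_enum; congr (_ + _).
  by apply: eq_bigr => i _; rewrite gdist_sh.
by apply: eq_bigr => i _; rewrite gdist_k.
Qed.

Lemma size_enc c : size (enc c) = m + n.
Proof. by rewrite size_cat size_map [in X in _ + X]size_map !size_enum_ord. Qed.

Lemma nth_encS c (i : 'I_m) : nth 0 (enc c) i = encS (c.1 i).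
Proof.
rewrite nth_cat size_map size_enum_ord ltn_ord (nth_map i) ?size_enum_ord //.
by rewrite nth_ord_enum.
Qed.

Lemma nth_encK c (j : 'I_n) : nth 0 (enc c) (m + j) = (c.2 j : 'Z_4).
Proof.
rewrite nth_cat size_map size_enum_ord ltnNge leq_addr /= addKn.
by rewrite (nth_map j) ?size_enum_ord // nth_ord_enum.
Qed.

Lemma encK : cancel enc decW.
Proof.
move=> c; rewrite [RHS]surjective_pairing; congr pair; apply/ffunP => i.
  by rewrite ffunE nth_encS encSK.
rewrite ffunE nth_encK; apply: val_inj => /=.
by rewrite modn_small // ltn_ord.
Qed.

Lemma enc_inj : injective enc.
Proof. exact: can_inj encK. Qed.

Definition validw (w : seq nat) : bool :=
  [&& size w == m + n, all (fun x => x < 16) (take m w)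
    & all (fun x => x < 4) (drop m w)].

Lemma valid_enc c : validw (enc c).
Proof.
rewrite /validw size_enc eqxx /=.
have -> : m = size [seq encS (c.1 i) | i <- enum 'I_m].
  by rewrite size_map size_enum_ord.
rewrite take_size_cat // drop_size_cat //; apply/andP; split; apply/allP => x.
  by case/mapP => i _ ->; apply: encS_lt.
by case/mapP => i _ ->; apply: ltn_ord.
Qed.

Lemma decWK w : validw w -> enc (decW w) = w.
Proof.
case/and3P=> /eqP sz /(all_nthP 0) h1 /(all_nthP 0) h2.
have sm : m <= size w by rewrite sz leq_addr.
apply: (@eq_from_nth _ 0); first by rewrite size_enc sz.
rewrite size_enc => i hi; have [im|mi] := ltnP i m.
  rewrite (nth_encS _ (Ordinal im)) ffunE decSK //=.
  by have := h1 i; rewrite size_takel // nth_take //; apply.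
have hj : i - m < n by lia.
have -> : i = m + Ordinal hj by rewrite /= subnKC.
rewrite nth_encK ffunE /= modn_small //.
by have := h2 (i - m); rewrite size_drop nth_drop; apply; lia.
Qed.

Definition dec (W : seq (seq nat)) : {set doobV m n} := [set c | enc c \in W].

Lemma perm_enc_dec W : uniq W -> all validw W ->
  perm_eq [seq enc c | c <- enum (dec W)] W.
Proof.
move=> uW /allP vW; apply: uniq_perm => //.
  by rewrite map_inj_uniq ?enum_uniq //; apply: enc_inj.
move=> w; apply/mapP/idP => [[c]|wW]; first by rewrite mem_enum inE => h ->.
by exists (decW w); rewrite ?mem_enum ?inE decWK // vW.
Qed.

Lemma card_dec W : uniq W -> all validw W -> #|dec W| = size W.
Proof.
by move=> uW vW; rewrite cardE -(perm_size (perm_enc_dec uW vW)) size_map.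
Qed.

Lemma eq_dec W W' : W =i W' -> dec W = dec W'.
Proof. by move=> h; apply/setP => c; rewrite !inE h. Qed.

(** Evaluable form of [mds_code]: it uses table distances and does not quantify over the vertices of
    D(m, n). *)
Definition mdsw (k : nat) (W : seq (seq nat)) : bool :=
  let d := 2 * m + n - k + 1 in
  [&& uniq W, all validw W, size W == 4 ^ k,
      has (fun w => has (fun v => (w != v) && (wdist m w v == d)) W) W &
      all (fun w => all (fun v => (w == v) || (d <= wdist m w v)) W) W].

Lemma mdsw_dec k W : mdsw k W -> mds_code k (dec W).
Proof.
case/and5P=> uW vW sW hd /allP ha; rewrite /mds_code card_dec // sW /=.
apply/andP; split.
  case/hasP: hd => w wW /hasP[v vW' /andP[wv dwv]].
  apply/existsP; exists (decW w); rewrite inE decWK ?(allP vW) // wW /=.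
  apply/existsP; exists (decW v); rewrite inE decWK ?(allP vW) // vW' /=.
  rewrite doob_dist_enc !decWK ?(allP vW) // dwv andbT.
  by apply: contra_neq wv => /(congr1 enc); rewrite !decWK ?(allP vW).
apply/forallP => c; apply/implyP; rewrite inE => cW.
apply/forallP => c'; apply/implyP; rewrite inE => cW'; apply/implyP => cc'.
have /allP/(_ _ cW') := ha _ cW; rewrite -doob_dist_enc => /orP[/eqP|//].
by move/enc_inj => e; rewrite e eqxx in cc'.
Qed.

End Encoding.

(** * Enumeration of words, and equivalences given by tables *)

Fixpoint wordsK (n : nat) : seq (seq nat) :=
  match n with
  | n'.+1 => flatten [seq [seq x :: w | w <- wordsK n'] | x <- iota 0 4]
  | 0 => [:: [::]]
  end.

Fixpoint words (m n : nat) : seq (seq nat) :=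
  match m with
  | m'.+1 => flatten [seq [seq x :: w | w <- words m' n] | x <- iota 0 16]
  | 0 => wordsK n
  end.

Lemma mem_cons_words (s : seq nat) (W : seq (seq nat)) x w :
  x \in s -> w \in W -> x :: w \in flatten [seq [seq y :: v | v <- W] | y <- s].
Proof.
move=> xs wW; apply/flattenP; exists [seq x :: v | v <- W]; last exact: map_f.
by apply/mapP; exists x.
Qed.

Lemma mem_words m n w : validw m n w -> w \in words m n.
Proof.
elim: m w => [|m IH] w.
  case/and3P=> /eqP; rewrite take0 drop0 => + _.
  elim: n w => [[]//|n IH] [//|x w] [/IH sz] /andP[hx hw].
  apply: (@mem_cons_words (iota 0 4) (wordsK n)); first by rewrite mem_iota.
  exact: sz.
case: w => [//|x w] /and3P[sz /= /andP[hx hw] hv].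
apply: (@mem_cons_words (iota 0 16) (words m n)); first by rewrite mem_iota.
by apply: IH; rewrite /validw -eqSS sz hw.
Qed.

Lemma perm_of_list N (l : seq nat) : perm_eq l (iota 0 N) ->
  exists s : 'S_N, forall i, s i = nth 0 l i :> nat.
Proof.
move=> pl; have sz : size l = N by rewrite (perm_size pl) size_iota.
have lt (i : 'I_N) : nth 0 l i < N.
  have : nth 0 l i \in l by rewrite mem_nth ?sz.
  by rewrite (perm_mem pl) mem_iota.
pose f i := Ordinal (lt i).
have fI : injective f.
  move=> i j [] /eqP; rewrite nth_uniq ?sz ?(perm_uniq pl) ?iota_uniq //.
  by move=> /eqP/val_inj.
by exists (perm fI) => i; rewrite permE.
Qed.

Definition autl (a : seq nat) : bool :=
  perm_eq a (iota 0 16) &&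
  all (fun x => all (fun y => adjn (nth 0 a x) (nth 0 a y) == adjn x y)
    (iota 0 16)) (iota 0 16).

Lemma sh_aut_of_list a : autl a ->
  exists2 t : {perm shV}, sh_aut t & forall u, encS (t u) = nth 0 a (encS u).
Proof.
case/andP=> pa ha.
have sz : size a = 16 by rewrite (perm_size pa) size_iota.
have lt u : nth 0 a (encS u) < 16.
  have : nth 0 a (encS u) \in a by rewrite mem_nth // sz encS_lt.
  by rewrite (perm_mem pa) mem_iota.
pose f u := decS (nth 0 a (encS u)).
have fE u : encS (f u) = nth 0 a (encS u) by rewrite decSK.
have fI : injective f.
  move=> u v /(congr1 encS); rewrite !fE => /eqP.
  rewrite nth_uniq ?sz ?encS_lt ?(perm_uniq pa) ?iota_uniq //.
  by move=> /eqP/encS_inj.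
exists (perm fI); last by move=> u; rewrite permE fE.
apply/sh_autP => u v; rewrite !permE !sh_adjE !fE.
exact: (eqP (forall_sh2 ha u v)).
Qed.

Definition eqvdata (m n : nat) (th sg : seq (seq nat)) (p r : seq nat) : bool :=
  [&& size th == m, all autl th, size sg == n,
      all (fun s => perm_eq s (iota 0 4)) sg,
      perm_eq p (iota 0 m) & perm_eq r (iota 0 n)].

Definition mapw (m n : nat) (th sg : seq (seq nat)) (p r : seq nat)
    (w : seq nat) : seq nat :=
  [seq nth 0 (nth [::] th i) (nth 0 w (nth 0 p i)) | i <- iota 0 m] ++
  [seq nth 0 (nth [::] sg j) (nth 0 w (m + nth 0 r j)) | j <- iota 0 n].

Lemma code_map_of_data m n th sg p r : eqvdata m n th sg p r ->
  exists (t : {ffun 'I_m -> {perm shV}}) (s : {ffun 'I_n -> {perm kV}})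
    (pi : 'S_m) (rho : 'S_n), (forall i, sh_aut (t i)) /\
    forall c, enc (code_map t s pi rho c) = mapw m n th sg p r (enc c).
Proof.
case/and5P=> /eqP szt /allP ht /eqP szs /allP hs.
case/andP=> /perm_of_list[pi pE] /perm_of_list[rho rE].
(* The existence claims are stated with boolean predicates so that [xchoose] can select one
   permutation per coordinate. *)
have exT (i : 'I_m) : exists t : {perm shV}, sh_aut t &&
    [forall u, encS (t u) == nth 0 (nth [::] th i) (encS u)].
  have [|t at_ tE] := @sh_aut_of_list (nth [::] th i).
    by apply/ht/mem_nth; rewrite szt.
  by exists t; rewrite at_; apply/forallP => u; rewrite tE.
have exS (j : 'I_n) : exists s : {perm kV},
    [forall x : 'Z_4, (s x : 'Z_4) == nth 0 (nth [::] sg j) x :> nat].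
  have [|s sE] := @perm_of_list 4 (nth [::] sg j).
    by apply/hs/mem_nth; rewrite szs.
  by exists s; apply/forallP => x; rewrite sE.
exists [ffun i => xchoose (exT i)], [ffun j => xchoose (exS j)], pi, rho.
have tP i := andP (xchooseP (exT i)); have sP j := forallP (xchooseP (exS j)).
split=> [i|c]; first by rewrite ffunE; case: (tP i).
apply: (@eq_from_nth _ 0).
  by rewrite size_enc /mapw size_cat; congr (_ + _); rewrite size_map size_iota.
rewrite size_enc => k hk; rewrite [in RHS]nth_cat size_map size_iota.
have [km|mk] := ltnP k m.
  rewrite (nth_encS _ (Ordinal km)) !ffunE (nth_map 0) ?size_iota //.
  rewrite nth_iota // add0n -(pE (Ordinal km)) nth_encS.
  by case: (tP (Ordinal km)) => _ /forallP/(_ (c.1 (pi (Ordinal km))))/eqP ->.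
have kn : k - m < n by lia.
have {1}-> : k = m + Ordinal kn by rewrite /= subnKC.
rewrite nth_encK !ffunE (nth_map 0) ?size_iota // nth_iota // add0n.
by rewrite -(rE (Ordinal kn)) nth_encK (eqP (sP _ _)).
Qed.

Lemma code_equiv_mapw m n th sg p r W : eqvdata m n th sg p r ->
  all (validw m n) W ->
  code_equiv (dec m n W) (dec m n [seq mapw m n th sg p r w | w <- W]).
Proof.
move=> /code_map_of_data[t [s [pi [rho [ht E]]]]] /allP vW.
apply/code_equivP; exists t, s, pi, rho; split=> //.
apply/setP => c; rewrite inE; apply/mapP/imsetP => [[w wW ec]|[c' c'W ->]].
  exists (decW m n w); first by rewrite inE decWK // vW.
  by apply: enc_inj; rewrite E decWK // vW.
by exists (enc c'); rewrite ?E //; rewrite inE in c'W.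
Qed.

(** * Backtracking search *)

(* [all] and [has] with a conditional in place of [&&] and [||]: evaluation
   by value then stops at the first decisive element. *)
Fixpoint allb (T : Type) (a : pred T) (s : seq T) : bool :=
  if s is x :: s' then if a x then allb a s' else false else true.

Fixpoint hasb (T : Type) (a : pred T) (s : seq T) : bool :=
  if s is x :: s' then if a x then true else hasb a s' else false.

Lemma allbE (T : Type) (a : pred T) s : allb a s = all a s.
Proof. by elim: s => //= x s ->. Qed.

Lemma hasbE (T : Type) (a : pred T) s : hasb a s = has a s.
Proof. by elim: s => //= x s ->. Qed.

Fixpoint eqw (w v : seq nat) : bool :=
  match w, v with
  | x :: w', y :: v' => if eqn x y then eqw w' v' else false
  | [::], [::] => true
  | _, _ => false
  end.

Lemma eqwE w v : eqw w v = (w == v).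
Proof. by elim: w v => [|x w IH] [|y v] //=; rewrite IH eqseq_cons eqnE. Qed.

Definition memw (W : seq (seq nat)) (w : seq nat) : bool := hasb (eqw w) W.

Lemma memwE W w : memw W w = (w \in W).
Proof.
rewrite /memw hasbE -has_pred1; apply: eq_has => v.
by rewrite eqwE eq_sym.
Qed.

Fixpoint search (T : Type) (ok : T -> T -> bool) (doms : seq (seq T))
    (s : seq T) : seq (seq T) :=
  if doms is dm :: doms' then
    flatten [seq search ok doms' (y :: s) | y <- dm & allb (ok y) s]
  else [:: s].

(** Completeness of the backtracking: a compatible choice of one element per domain passes every
    test on the way, so it survives to a leaf. Results appear reversed because [s] collects the
    chosen elements at its head. *)
Lemma mem_search (T : eqType) (ok : rel T) doms t s :
  all2 (fun x (dm : seq T) => x \in dm) t doms ->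
  pairwise (fun a b => ok b a) t -> all (fun b => all (ok b) s) t ->
  catrev t s \in search ok doms s.
Proof.
elim: doms t s => [|dm doms IH] [|x t] s //=; first by rewrite mem_seq1.
case/andP=> xd td /andP[/allP xt pt] /andP[xs /allP ts].
apply/flattenP; exists (search ok doms (x :: s)).
  by apply: map_f; rewrite mem_filter allbE xs.
apply: IH => //; apply/allP => y yt /=.
by rewrite (xt y yt) /=; apply: ts.
Qed.

(** * Counting classes by representatives, and invariance of distances *)

Section Classes.
Variables m n k : nat.
Implicit Types C : {set doobV m n}.

(** Sending a representative to its class is injective by inequivalence and onto by completeness of
    the list. *)
Lemma L_reps (rs : seq {set doobV m n}) : all (mds_code k) rs ->
  pairwise (fun C C' => ~~ code_equiv C C') rs ->
  (forall C, mds_code k C -> has (code_equiv C) rs) -> L m n k = size rs.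
Proof.
move=> /allP hm hp hc; rewrite /L; set D := [set C | mds_code k C].
pose cl C := [set C' in D | code_equiv C C'].
have u : uniq (map cl rs).
  rewrite uniq_pairwise pairwise_map; apply: (sub_in_pairwise (P := mem rs)) (allss rs) hp.
  move=> C C' hC hC' /=; apply: contra => /eqP e.
  have : C' \in cl C' by rewrite !inE code_equiv_refl hm.
  by rewrite -e inE => /andP[].
rewrite -(size_map cl) -(card_uniqP u); apply: eq_card => X.
apply/imsetP/mapP => [[C]|[C hC ->]]; last by exists C; rewrite ?inE ?hm.
rewrite in_set => mC ->; have /hasP[C' hC' CC'] := hc C mC.
exists C'; first exact: hC'.
have E : code_equiv C =1 code_equiv C'.
  move=> Y; apply/idP/idP; last exact: code_equiv_trans CC'.
  by apply: code_equiv_trans; rewrite code_equiv_sym.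
by rewrite /cl; apply: eq_finset => Y; rewrite E.
Qed.

Lemma L_eq0 : (forall C, ~~ mds_code k C) -> L m n k = 0.
Proof. by move=> h; apply: (@L_reps [::]) => // C; rewrite (negPf (h C)). Qed.

Lemma code_equiv_card C C' : code_equiv C C' -> #|C'| = #|C|.
Proof.
have le X Y : @code_equiv m n X Y -> #|Y| <= #|X|.
  by move=> /code_equivP[t [s [p [r [_ ->]]]]]; apply: leq_imset_card.
move=> h; apply/eqP; rewrite eqn_leq (le _ _ h); apply: le.
by rewrite code_equiv_sym.
Qed.

End Classes.

Lemma gdist_shE u v :
  gdist sh_adj u v = if u == v then 0 else if sh_adj u v then 1 else 2.
Proof.
rewrite gdist_sh sh_adjE -(inj_eq encS_inj); apply/eqP.
apply: (@forall_sh2 (fun x y =>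
  dsh x y == if x == y then 0 else if adjn x y then 1 else 2)).
by vm_compute.
Qed.

Lemma gdist_sh_le2 u v : gdist sh_adj u v <= 2.
Proof. by rewrite gdist_shE; case: ifP => // _; case: ifP. Qed.

Section CodeMap.
Variables (m n : nat) (t : {ffun 'I_m -> {perm shV}}).
Variables (s : {ffun 'I_n -> {perm kV}}) (pi : 'S_m) (rho : 'S_n).

Lemma code_map_inj : injective (code_map t s pi rho).
Proof.
move=> c c' [/ffunP h1 /ffunP h2].
rewrite [c]surjective_pairing [c']surjective_pairing.
congr pair; apply/ffunP => i.
  by have := h1 (pi^-1 i)%g; rewrite !ffunE permKV => /perm_inj.
by have := h2 (rho^-1 i)%g; rewrite !ffunE permKV => /perm_inj.
Qed.

Hypothesis ht : forall i, sh_aut (t i).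

Lemma doob_dist_code_map c c' :
  doob_dist (code_map t s pi rho c) (code_map t s pi rho c') = doob_dist c c'.
Proof.
rewrite !doob_distE [in RHS](reindex_inj (@perm_inj _ pi)) /=.
rewrite [X in _ = _ + X](reindex_inj (@perm_inj _ rho)) /=.
congr (_ + _); apply: eq_bigr => i _; rewrite !ffunE.
  by rewrite !gdist_shE (inj_eq perm_inj) (sh_autP _ (ht i)).
by rewrite !gdist_k (inj_eq perm_inj).
Qed.

End CodeMap.

Lemma doob_dist_le m n (c c' : doobV m n) : doob_dist c c' <= 2 * m + n.
Proof.
rewrite doob_distE; apply: leq_add.
  apply: (@leq_trans (\sum_(i < m) 2)); last by rewrite sum_nat_const card_ord mulnC.
  by apply: leq_sum => i _; apply: gdist_sh_le2.
apply: (@leq_trans (\sum_(i < n) 1)); last by rewrite sum_nat_const card_ord muln1.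
by apply: leq_sum => i _; rewrite gdist_k leq_b1.
Qed.

(** Only the lower bound on distances is kept: unlike an exact code distance, it passes to subcodes,
    layers and fibres. *)
Definition mind m n (C : {set doobV m n}) (d : nat) : Prop :=
  forall c c', c \in C -> c' \in C -> c != c' -> d <= doob_dist c c'.

Lemma mds_codeW m n k (C : {set doobV m n}) : mds_code k C ->
  #|C| = 4 ^ k /\ mind C (2 * m + n - k + 1).
Proof.
case/andP=> /eqP cC /andP[_ /forallP h]; split=> // c c' cC1 cC2.
by have /implyP/(_ cC1)/forallP/(_ c')/implyP/(_ cC2)/implyP := h c.
Qed.

Lemma mind_sub m n (A C : {set doobV m n}) d :
  A \subset C -> mind C d -> mind A d.
Proof. by move=> /subsetP AC h c c' /AC cC /AC; apply: h. Qed.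

Lemma mind_equiv m n (C C' : {set doobV m n}) d :
  code_equiv C C' -> mind C d -> mind C' d.
Proof.
case/code_equivP=> t [s [p [r [ht ->]]]] h c c' /imsetP[x xC ->].
case/imsetP=> y yC ->; rewrite (inj_eq (@code_map_inj _ _ t s p r)).
by rewrite (doob_dist_code_map _ _ _ ht); apply: h.
Qed.

(** * Adding, removing and fixing a coordinate *)

Section Coordinates.
Variables m n : nat.

Definition addK (c : doobV m n) (a : 'Z_4) : doobV m n.+1 :=
  (c.1, [ffun j => if unlift ord_max j is Some i then c.2 i else a]).

Definition remK (c : doobV m n.+1) : doobV m n :=
  (c.1, [ffun j => c.2 (lift ord_max j)]).

Definition addS (x : shV) (c : doobV m n) : doobV m.+1 n :=
  ([ffun i => if unlift ord0 i is Some j then c.1 j else x], c.2).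

Definition remS (c : doobV m.+1 n) : doobV m n :=
  ([ffun i => c.1 (lift ord0 i)], c.2).

Lemma remKK (c : doobV m n.+1) : addK (remK c) (c.2 ord_max) = c.
Proof.
rewrite [RHS]surjective_pairing; congr pair; apply/ffunP => j.
by rewrite ffunE; case: unliftP => [i ->|->//]; rewrite ffunE.
Qed.

Lemma addKK c a : remK (addK c a) = c.
Proof.
rewrite [RHS]surjective_pairing; congr pair; apply/ffunP => j.
by rewrite !ffunE liftK.
Qed.

Lemma remSK (c : doobV m.+1 n) : addS (c.1 ord0) (remS c) = c.
Proof.
rewrite [RHS]surjective_pairing; congr pair; apply/ffunP => j.
by rewrite ffunE; case: unliftP => [i ->|->//]; rewrite ffunE.
Qed.

Lemma doob_distK (c c' : doobV m n.+1) : doob_dist c c' =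
  doob_dist (remK c) (remK c') + (c.2 ord_max != c'.2 ord_max).
Proof.
rewrite !doob_distE big_ord_recr /= gdist_k addnA; congr (_ + _ + _).
apply: eq_bigr => i _; rewrite !ffunE.
have -> // : widen_ord (leqnSn n) i = lift ord_max i.
by apply: val_inj; rewrite /= /bump leqNgt ltn_ord.
Qed.

Lemma doob_distS (c c' : doobV m.+1 n) : doob_dist c c' =
  gdist sh_adj (c.1 ord0) (c'.1 ord0) + doob_dist (remS c) (remS c').
Proof.
rewrite !doob_distE big_ord_recl -addnA; congr (_ + (_ + _)).
by apply: eq_bigr => i _; rewrite !ffunE.
Qed.

Lemma enc_addK c a : enc (addK c a) = rcons (enc c) a.
Proof.
rewrite /enc /addK /= enum_ordSr map_rcons -map_comp rcons_cat ffunE.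
rewrite unlift_none; congr (_ ++ rcons _ _); apply: eq_map => i /=.
rewrite ffunE (_ : widen_ord _ i = lift ord_max i) ?liftK //.
by apply: val_inj; rewrite /= /bump leqNgt ltn_ord.
Qed.

Lemma head_enc (c : doobV m.+1 n) : head 0 (enc c) = encS (c.1 ord0).
Proof. by rewrite -nth0 (nth_encS c ord0). Qed.

Definition layer (C : {set doobV m n.+1}) (a : 'Z_4) : {set doobV m n} :=
  [set c | addK c a \in C].

Lemma mind_layer (C : {set doobV m n.+1}) a d : mind C d -> mind (layer C a) d.
Proof.
move=> h c c'; rewrite in_set => cC; rewrite in_set => cC' cc'.
have := h _ _ cC cC'; rewrite doob_distK !addKK !ffunE !unlift_none eqxx addn0.
by apply; apply: contra_neq cc' => /(congr1 remK); rewrite !addKK.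
Qed.

Lemma card_layers (C : {set doobV m n.+1}) : #|C| = \sum_(a : 'Z_4) #|layer C a|.
Proof.
rewrite -sum1_card (partition_big (fun c : doobV m n.+1 => c.2 ord_max : 'Z_4) xpredT) //=.
apply: eq_bigr => a _; rewrite sum1_card -(card_imset _ (can_inj (addKK ^~ a))).
apply: eq_card => c; apply/andP/imsetP => [[cC /eqP <-]|[x]].
  by exists (remK c); rewrite ?in_set remKK.
by rewrite in_set => xC ->; rewrite xC ffunE unlift_none eqxx.
Qed.

(** The equivalence of layers is extended by the identity on the last coordinate, which also stays
    in place. *)
Lemma code_equiv_layer C R a : code_equiv (layer C a) R ->
  exists2 C', code_equiv C C' & layer C' a = R.
Proof.
case/code_equivP=> t [s [p [r [ht ->]]]].
pose s' : {ffun 'I_n.+1 -> {perm kV}} :=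
  [ffun j => if unlift ord_max j is Some i then s i else 1%g].
pose r' := lift_perm ord_max ord_max r.
have E c b : code_map t s' p r' (addK c b) = addK (code_map t s p r c) b.
  congr pair; apply/ffunP => j; rewrite !ffunE.
  case: unliftP => [i ->|->].
    by rewrite lift_perm_lift ?lift_perm_id !ffunE ?liftK // ffunE.
  by rewrite lift_perm_id unlift_none perm1.
exists [set code_map t s' p r' c | c in C].
  by apply/code_equivP; exists t, s', p, r'.
apply/setP => c; rewrite inE; apply/imsetP/imsetP => [[x xC cx]|[x xC ->]].
  exists (remK x); last first.
    by rewrite -(addKK (code_map _ _ _ _ (remK x)) (x.2 ord_max)) -E remKK -cx addKK.
  rewrite in_set; suff -> : a = x.2 ord_max by rewrite remKK.
  move: cx; rewrite -[x]remKK E => /(congr1 snd)/ffunP/(_ ord_max).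
  by rewrite !ffunE !unlift_none.
by exists (addK x a); rewrite ?E //; rewrite in_set in xC.
Qed.

End Coordinates.

(** Sorting the words by an index that is injective on the code puts the word of index i at position
    i; a search may then restrict position i to words of that index. *)
Lemma cover m n N (inf : seq nat -> nat) (C : {set doobV m n}) :
  #|C| = N -> (forall c, c \in C -> inf (enc c) < N) ->
  {in C &, injective (fun c => inf (enc c))} ->
  exists t, [/\ [seq inf w | w <- t] = iota 0 N, dec m n t = C &
                all (validw m n) t].
Proof.
move=> cC lt inj; pose u := [seq enc c | c <- enum C].
pose t := sort (fun w v => inf w <= inf v) u.
have pt : perm_eq t u by rewrite perm_sort.
exists t; split; last first.
- apply/allP => w; rewrite (perm_mem pt) => /mapP[c _ ->]; apply: valid_enc.
- apply/setP => c; rewrite inE (perm_mem pt) mem_map ?mem_enum //.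
  exact: enc_inj.
have pm := perm_map inf pt.
apply: (sorted_eq leq_trans anti_leq) (iota_sorted 0 N) _.
  by rewrite sorted_map; apply: sort_sorted => x y; apply: leq_total.
apply: uniq_perm; rewrite ?iota_uniq //.
  rewrite (perm_uniq pm) -map_comp map_inj_in_uniq ?enum_uniq // => x y.
  by rewrite !mem_enum; apply: inj.
apply: (uniq_min_size _ _ _).2 => [||].
- rewrite (perm_uniq pm) -map_comp map_inj_in_uniq ?enum_uniq // => x y.
  by rewrite !mem_enum; apply: inj.
- move=> i; rewrite (perm_mem pm) -map_comp => /mapP[c cE ->].
  by rewrite mem_iota /= lt // -mem_enum.
by rewrite size_iota size_map (perm_size pt) size_map -cardE cC.
Qed.

Definition translation (t : nat) : seq nat :=
  [seq 4 * ((x %/ 4 + 4 - t %/ 4) %% 4) + (x %% 4 + 4 - t %% 4) %% 4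
  | x <- iota 0 16].

Lemma sh_aut_to0 t : exists2 theta, sh_aut theta & encS (theta t) = 0.
Proof.
have h : all (fun x => autl (translation x) && (nth 0 (translation x) x == 0))
  (iota 0 16) by vm_compute.
have /andP[/sh_aut_of_list[theta ht E] /eqP h0] := forall_sh h t.
by exists theta; rewrite ?E.
Qed.

(** Indices in the list of a, b, c give the permutation: the missing colour gets 3, the length of
    the list. *)
Lemma perm_k3 (a b c : 'Z_4) : a != b -> a != c -> b != c ->
  exists s : {perm kV}, [/\ (s a : 'Z_4) = 0 :> nat, (s b : 'Z_4) = 1 :> nat
                          & (s c : 'Z_4) = 2 :> nat].
Proof.
move=> ab ac bc; pose l := [seq index x [:: val a; val b; val c] | x <- iota 0 4].
have h : all (fun x => all (fun y => all (fun z =>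
    [&& x != y, x != z & y != z] ==>
    let l := [seq index i [:: x; y; z] | i <- iota 0 4] in
    [&& perm_eq l (iota 0 4), nth 0 l x == 0, nth 0 l y == 1 & nth 0 l z == 2])
  (iota 0 4)) (iota 0 4)) (iota 0 4) by vm_compute.
have I (x : 'Z_4) : val x \in iota 0 4 by rewrite mem_iota ltn_ord.
have /implyP := allP (allP (allP h _ (I a)) _ (I b)) _ (I c).
rewrite !(inj_eq val_inj) ab ac bc -/l => /(_ isT)/and4P[pl /eqP la /eqP lb /eqP lc].
have [s sE] := perm_of_list pl.
by exists s; rewrite !sE.
Qed.

(** * Codes that are graphs over the first coordinate *)

Section MaximalDistance.
Variables m n : nat.
Implicit Types C : {set doobV m.+1 n}.

(** The coordinates other than the first contribute at most 2 m + n, one less than the required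
    distance. *)
Lemma head_inj C : mind C (2 * m + n + 1) ->
  {in C &, injective (fun c : doobV m.+1 n => c.1 ord0)}.
Proof.
move=> h c c' cC cC' /= e; apply/eqP; apply: contraT => cc'.
have := h _ _ cC cC' cc'; rewrite doob_distS e gdistxx add0n addn1 ltnNge.
by rewrite doob_dist_le.
Qed.

Lemma card_le16 C : mind C (2 * m + n + 1) -> #|C| <= 16.
Proof.
move=> /head_inj/card_in_imset <-; apply: leq_trans (max_card _) _.
by rewrite card_prod !card_ord.
Qed.

Lemma head_surj C x : #|C| = 16 -> mind C (2 * m + n + 1) ->
  exists2 c, c \in C & c.1 ord0 = x.
Proof.
move=> cC /head_inj/card_in_imset e.
have : x \in [set c.1 ord0 | c : doobV m.+1 n in C].
  suff -> : [set c.1 ord0 | c : doobV m.+1 n in C] = setT by rewrite inE.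
  apply/eqP; rewrite eqEcard subsetT cardsT card_prod !card_ord e.
  by rewrite cC.
by case/imsetP => c cC' ->; exists c.
Qed.

(** Adjacent first coordinates contribute 1, so the remaining ones must reach their total maximum 2
    m + n; a repeated colour would lose one. *)
Lemma adj_heads C c c' : mind C (2 * m + n + 1) -> c \in C -> c' \in C ->
  sh_adj (c.1 ord0) (c'.1 ord0) -> forall j, c.2 j != c'.2 j.
Proof.
move=> h cC cC' a j; have cc' : c.1 ord0 != c'.1 ord0.
  by apply: contraTneq a => ->; rewrite sh_adjE; apply: (@forall_sh (fun x => ~~ adjn x x)).
have := h _ _ cC cC'; rewrite doob_distS gdist_shE (negPf cc') a.
have -> : c != c' by apply: contra_neq cc' => ->.
move=> /(_ isT); apply: contraTneq => e; rewrite -ltnNge addn1 ltnS.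
rewrite add1n doob_distE -addnS; apply: leq_add; last first.
  rewrite (bigD1 j) //= gdist_k e eqxx add0n.
  apply: (@leq_trans (\sum_(i < n | i != j) 1).+1).
    by rewrite ltnS; apply: leq_sum => i _; rewrite gdist_k leq_b1.
  by rewrite sum1_card (cardC1 j) card_ord (ltn_predK (ltn_ord j)).
apply: (@leq_trans (\sum_(i < m) 2)); last by rewrite sum_nat_const card_ord mulnC.
by apply: leq_sum => i _; apply: gdist_sh_le2.
Qed.

(* 0, 1 and 5 encode a triangle of Sh: two words over adjacent first
   coordinates are at maximal distance in all other ones. *)
Definition normalw (w : seq nat) : bool :=
  if head 0 w == 0 then w == nseq (m.+1 + n) 0
  else if head 0 w == 1 then all (pred1 1) (drop m.+1 w)
  else if head 0 w == 5 then all (pred1 2) (drop m.+1 w)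
  else true.

Lemma normalize C : #|C| = 16 -> mind C (2 * m + n + 1) ->
  exists2 C', code_equiv C C' & forall c, c \in C' -> normalw (enc c).
Proof.
move=> cC mC.
have [c0 c0C c0E] := head_surj (decS 0) cC mC.
have [c1 c1C c1E] := head_surj (decS 1) cC mC.
have [c5 c5C c5E] := head_surj (decS 5) cC mC.
have exS (j : 'I_n) : exists s : {perm kV}, [&& (s (c0.2 j) : 'Z_4) == 0 :> nat,
    (s (c1.2 j) : 'Z_4) == 1 :> nat & (s (c5.2 j) : 'Z_4) == 2 :> nat].
  have adj c c' x y : c \in C -> c' \in C -> c.1 ord0 = decS x ->
    c'.1 ord0 = decS y -> sh_adj (decS x) (decS y) -> c.2 j != c'.2 j.
    by move=> hc hc' e e'; rewrite -e -e' => a; apply: (adj_heads mC).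
  have [|||s [h0 h1 h5]] := @perm_k3 (c0.2 j) (c1.2 j) (c5.2 j); last first.
  - by exists s; apply/and3P; split; apply/eqP.
  - exact: adj c1C c5C c1E c5E isT.
  - exact: adj c0C c5C c0E c5E isT.
  - exact: adj c0C c1C c0E c1E isT.
have exT (i : 'I_m.+1) : exists t : {perm shV},
    sh_aut t && (encS (t (c0.1 i)) == 0).
  by have [t h1 h2] := sh_aut_to0 (c0.1 i); exists t; rewrite h1 h2.
(* The first coordinate is left alone, so the words over 0, 1 and 5 stay over these vertices; the
   word over 0 already has first coordinate 0. *)
pose t := [ffun i => if i == ord0 then 1%g else xchoose (exT i)].
pose s := [ffun j => xchoose (exS j)].
have sP j := and3P (xchooseP (exS j)).
have t0 : t ord0 = 1%g by rewrite ffunE eqxx.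
have tS i : i != ord0 -> encS (t i (c0.1 i)) = 0.
  by rewrite ffunE => /negPf ->; case/andP: (xchooseP (exT i)) => _ /eqP.
have ht i : sh_aut (t i).
  rewrite ffunE; case: ifP => _; last by case/andP: (xchooseP (exT i)).
  by apply/sh_autP => x y; rewrite !perm1.
exists [set code_map t s 1 1 c | c in C].
  by apply/code_equivP; exists t, s, 1%g, 1%g.
move=> _ /imsetP[c cC' ->]; set c' := code_map _ _ _ _ c.
have hd : head 0 (enc c') = encS (c.1 ord0).
  by rewrite head_enc ffunE t0 !perm1.
have uniq_c x (d : doobV m.+1 n) : d \in C -> d.1 ord0 = decS x ->
    encS (c.1 ord0) = x -> c = d.
  move=> dC dE xE; apply: (head_inj mC) => //=.
  by rewrite dE -xE encSK.
have dropE (P : pred nat) : (forall j, P (nat_of_ord (c'.2 j : 'Z_4))) ->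
    all (fun x => P x) (drop m.+1 (enc c')).
  move=> hP; have sz : size [seq encS (c'.1 i) | i <- enum 'I_m.+1] = m.+1.
    by rewrite size_map size_enum_ord.
  rewrite /enc (drop_size_cat _ sz).
  by apply/allP => x /mapP[j _ ->].
rewrite /normalw hd; case: ifP => [/eqP h0|_].
  have e := uniq_c _ _ c0C c0E h0.
  apply/eqP; apply: (@eq_from_nth _ 0); rewrite size_enc ?size_nseq // => k hk.
  rewrite nth_nseq hk; have [km|mk] := ltnP k m.+1.
    rewrite (nth_encS c' (Ordinal km)) ffunE perm1 e.
    have [->|/tS //] := eqVneq (Ordinal km) ord0.
    by rewrite t0 perm1 -e.
  have kn : k - m.+1 < n by lia.
  have {1}-> : k = m.+1 + Ordinal kn by rewrite /= subnKC.
  rewrite nth_encK !ffunE perm1 e.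
  by case: (sP (Ordinal kn)) => /eqP.
case: ifP => [/eqP h1|_].
  have e := uniq_c _ _ c1C c1E h1.
  by apply: (dropE (pred1 1)) => j; rewrite !ffunE perm1 e; case: (sP j).
case: ifP => [/eqP h5|//].
have e := uniq_c _ _ c5C c5E h5.
by apply: (dropE (pred1 2)) => j; rewrite !ffunE perm1 e; case: (sP j).
Qed.

Definition dom2 (x : nat) : seq (seq nat) :=
  if x == 0 then [:: nseq (m.+1 + n) 0]
  else [seq w <- [seq x :: w | w <- words m n] | normalw w].

Definition search2 : seq (seq (seq nat)) :=
  search (fun y x => 2 * m + n < wdist m.+1 y x)
    [seq dom2 x | x <- iota 0 16] [::].

(** Codes are compared as sets, because an image of a representative may list its words in another
    order than the search does. *)
Definition wreach (orb : seq (seq (seq nat))) (W : seq (seq nat)) : bool :=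
  hasb (fun W' => if allb (memw W') W then allb (memw W) W' else false) orb.

Lemma dec_wreach M N orb W : wreach orb W ->
  exists2 W', W' \in orb & dec M N W = dec M N W'.
Proof.
rewrite /wreach hasbE => /hasP[W' W'o].
rewrite !allbE => /andP[/allP h1 /allP h2]; exists W' => //.
by apply: eq_dec => w; apply/idP/idP => [/h1|/h2]; rewrite memwE.
Qed.

Lemma all2_dom (T U : eqType) (f : T -> U) (dom : U -> seq T) t s :
  [seq f w | w <- t] = s -> (forall w, w \in t -> w \in dom (f w)) ->
  all2 (fun w (d : seq T) => w \in d) t [seq dom x | x <- s].
Proof.
move=> <- {s}; elim: t => //= w t IH h; rewrite h ?mem_head //=.
by apply: IH => v vt; apply: h; rewrite in_cons vt orbT.
Qed.

Lemma pairwise_mind M N (C : {set doobV M N}) d t :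
  uniq t -> dec M N t = C -> all (validw M N) t -> mind C d.+1 ->
  pairwise (fun a b => d < wdist M b a) t.
Proof.
move=> ut <- /allP vt mC; rewrite uniq_pairwise in ut.
apply: (sub_in_pairwise (P := mem t)) (allss t) ut => v w vt' wt vw.
have inD x : x \in t -> decW M N x \in dec M N t.
  by move=> xt; rewrite inE decWK // vt.
have := mC _ _ (inD _ wt) (inD _ vt'); rewrite doob_dist_enc !decWK ?vt //.
apply; apply: contra_neq vw => /(congr1 (@enc M N)).
by rewrite !decWK ?vt.
Qed.

(** After normalisation the word over x lies in [dom2 x], and listing the words by first coordinate
    gives a choice that the search meets. *)
Lemma search2_complete C : #|C| = 16 -> mind C (2 * m + n + 1) ->
  exists2 W, W \in search2 & code_equiv C (dec m.+1 n W).
Proof.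
move=> cC mC; have [C' CC' nC'] := normalize cC mC.
have mC' := mind_equiv CC' mC.
have cC' : #|C'| = 16 by rewrite (code_equiv_card CC').
have [|c c' cC1 cC2|t [ht dt vt]] := cover (inf := head 0) cC'.
- by move=> c _; rewrite head_enc encS_lt.
- by rewrite !head_enc => /encS_inj; apply: (head_inj mC').
have ut : uniq t by apply: (@map_uniq _ _ (head 0)); rewrite ht iota_uniq.
exists (rev t); last first.
  by rewrite (@eq_dec _ _ (rev t) t) ?dt // => w; rewrite mem_rev.
rewrite /rev; apply: mem_search => //; last exact/allP.
- apply: all2_dom ht _ => w wt.
  have vw : validw m.+1 n w := allP vt _ wt.
  have nw : normalw w.
    have := nC' (decW m.+1 n w); rewrite decWK //; apply.
    by rewrite -dt inE decWK.
  rewrite /dom2; case: ifP => h0.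
    by move: nw; rewrite /normalw h0 mem_seq1.
  rewrite mem_filter nw /=; case: w vw {wt nw h0} => [|x w] vw; first by case/and3P: vw.
  apply/map_f/mem_words; case/and3P: vw => sz /= /andP[_ h1] h2.
  by rewrite /validw -eqSS sz h1 h2.
- by rewrite addn1 in mC'; apply: pairwise_mind ut dt vt mC'.
Qed.

End MaximalDistance.

(** * Orbits of representatives and the classification for k = 2 and k = 3 *)

Definition linear_map (p q r s : nat) : seq nat :=
  [seq 4 * ((p * (x %/ 4) + q * (x %% 4)) %% 4) + (r * (x %/ 4) + s * (x %% 4)) %% 4
  | x <- iota 0 16].

(** Twelve linear maps of Z_4^2 are automorphisms of Sh; they fix 0 and therefore keep the zero word
    of the normal form. *)
Definition stab0 : seq (seq nat) := Eval vm_compute in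
  [seq a <- [seq linear_map pq.1 pq.2 rs.1 rs.2
            | pq <- [seq (p, q) | p <- iota 0 4, q <- iota 0 4],
              rs <- [seq (r, s) | r <- iota 0 4, s <- iota 0 4]] | autl a].

Fixpoint seqs_of (T : Type) (A : seq T) (m : nat) : seq (seq T) :=
  if m is m'.+1 then [seq a :: t | a <- A, t <- seqs_of A m'] else [:: [::]].

(* In each K-coordinate, sends the colours over the vertices 0, 1, 5 to 0, 1, 2;
   the remaining colour has index 3 in the list of length 3. *)
Definition recolour (m n : nat) (W : seq (seq nat)) : seq (seq nat) :=
  let w x := nth [::] W (index x (map (head 0) W)) in
  let sg := [seq [seq index x [:: nth 0 (w 0) j; nth 0 (w 1) j; nth 0 (w 5) j]
                 | x <- iota 0 4] | j <- iota m n] in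
  if all (fun s => perm_eq s (iota 0 4)) sg
  then [seq mapw m n (nseq m (iota 0 16)) sg (iota 0 m) (iota 0 n) v | v <- W]
  else W.

(** Recolouring brings the images back to the normal form used by the search. Each listed code is
    proved equivalent to R in [orbit_equiv]; that the orbits cover everything found by the search is
    decided by computation, in [classified2]. *)
Definition orbit (m n : nat) (R : seq (seq nat)) : seq (seq (seq nat)) :=
  flatten
    [seq [seq recolour m n
           [seq mapw m n th (nseq n (iota 0 4)) pr.1 pr.2 w | w <- R]
         | pr <- [seq (p, r) | p <- permutations (iota 0 m),
                               r <- permutations (iota 0 n)]]
    | th <- seqs_of stab0 m].

Definition classified2 (m n : nat) (reps : seq (seq (seq nat))) : bool :=
  all (wreach (flatten [seq orbit m.+1 n R | R <- reps])) (search2 m n).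

(* The i-th word of a code with k = 3 has first coordinate i mod 16 and last
   coordinate i / 16, so the first 16 words are those of the given layer R. *)
Definition dom3 (m n : nat) (R : seq (seq nat)) (i : nat) : seq (seq nat) :=
  if i < 16 then [:: rcons (nth [::] R i) 0]
  else [seq rcons (i %% 16 :: w) (i %/ 16) | w <- words m n].

(** Adding one K-coordinate while raising k from 2 to 3 leaves d unchanged, so the distance
    threshold is that of [search2]. *)
Definition search3 (m n : nat) (R : seq (seq nat)) : seq (seq (seq nat)) :=
  search (fun y x => 2 * m + n < wdist m.+1 y x)
    [seq dom3 m n R i | i <- iota 0 64] [::].

(** Once the layer over 0 is a fixed representative, the extensions are matched up to renaming the
    values of the last coordinate. *)
Definition relayers (m n : nat) (W : seq (seq nat)) : seq (seq (seq nat)) :=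
  [seq [seq mapw m n.+1 (nseq m (iota 0 16)) (rcons (nseq n (iota 0 4)) s)
              (iota 0 m) (iota 0 n.+1) w | w <- W]
  | s <- permutations (iota 0 4)].

Definition classified3 (m n : nat) (reps reps3 : seq (seq (seq nat))) : bool :=
  all (fun R => all (wreach (flatten [seq relayers m.+1 n W | W <- reps3]))
                  (search3 m n R)) reps.

Lemma all_autl_nseq m : all autl (nseq m (iota 0 16)).
Proof. by rewrite all_nseq orbC; vm_compute. Qed.

Lemma all_perm_nseq n : all (fun s => perm_eq s (iota 0 4)) (nseq n (iota 0 4)).
Proof. by rewrite all_nseq perm_refl orbT. Qed.

Lemma mapw_valid m n th sg p r W : eqvdata m n th sg p r ->
  all (validw m n) W -> all (validw m n) [seq mapw m n th sg p r w | w <- W].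
Proof.
move=> /code_map_of_data[t [s [pi [rho [_ E]]]]] /allP vW.
apply/allP => _ /mapP[w wW ->]; rewrite -(decWK (vW w wW)) -E.
exact: valid_enc.
Qed.

Lemma seqs_ofP (A : seq (seq nat)) m th : th \in seqs_of A m ->
  size th = m /\ {subset th <= A}.
Proof.
elim: m th => [|m IH] th; first by rewrite mem_seq1 => /eqP ->.
case/allpairsP=> -[a t] /= [aA tA ->]; have [sz h] := IH _ tA.
split; first by rewrite /= sz.
by move=> x; rewrite in_cons => /orP[/eqP ->|/h].
Qed.

Lemma orbit_equiv m n R W : all (validw m n) R -> W \in orbit m n R ->
  code_equiv (dec m n R) (dec m n W).
Proof.
move=> vR /flattenP[X /mapP[th thP ->]].
case/mapP=> _ /allpairsP[[p r] /= [+ + ->]] ->.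
rewrite !mem_permutations /= => pp pr.
have h : eqvdata m n th (nseq n (iota 0 4)) p r.
  have [sz sub] := seqs_ofP thP.
  rewrite /eqvdata sz eqxx size_nseq eqxx all_perm_nseq pp pr /= andbT.
  have hs : all autl stab0 by vm_compute.
  by apply/allP => a /sub; apply: (allP hs).
apply: code_equiv_trans (code_equiv_mapw h vR) _.
have := mapw_valid h vR; set V := [seq _ | w <- R] => vV.
rewrite /recolour; case: ifP => [hs|_]; last exact: code_equiv_refl.
apply: code_equiv_mapw vV.
by rewrite /eqvdata !(size_nseq, size_map, size_iota) hs all_autl_nseq !eqxx !perm_refl.
Qed.

Lemma relayers_equiv m n R W : all (validw m n.+1) R -> W \in relayers m n R ->
  code_equiv (dec m n.+1 R) (dec m n.+1 W).
Proof.
move=> vR /mapP[s]; rewrite mem_permutations => ps ->.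
apply: code_equiv_mapw vR.
rewrite /eqvdata size_rcons !size_nseq !eqxx all_autl_nseq all_rcons ps.
by rewrite all_perm_nseq !perm_refl.
Qed.

Lemma classify2 m n reps : all (all (validw m.+1 n)) reps ->
  classified2 m n reps ->
  forall C : {set doobV m.+1 n}, #|C| = 16 -> mind C (2 * m + n + 1) ->
  has (code_equiv C) (map (dec m.+1 n) reps).
Proof.
move=> /allP vr /allP hr C cC mC; have [W /hr Wr CW] := search2_complete cC mC.
have [W' /flattenP[_ /mapP[R Rr ->] W'R] e] := dec_wreach m.+1 n Wr.
apply/hasP; exists (dec m.+1 n R); first exact: map_f.
apply: code_equiv_trans CW _; rewrite e code_equiv_sym.
exact: orbit_equiv (vr _ Rr) W'R.
Qed.

(** Each of the four layers is a graph over the first coordinate, with at most 16 words, so a total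
    of 64 forces equality. *)
Lemma layer_card16 m n (C : {set doobV m.+1 n.+1}) a :
  #|C| = 64 -> mind C (2 * m + n + 1) -> #|layer C a| = 16.
Proof.
move=> cC mC; have le b := card_le16 (mind_layer (a := b) mC).
have := card_layers C; rewrite cC (bigD1 a) //=.
have : \sum_(b : 'Z_4 | b != a) #|layer C b| <= \sum_(b : 'Z_4 | b != a) 16.
  by apply: leq_sum => b _; apply: le.
rewrite sum_nat_const (cardC1 a) card_ord => h e.
have {h} : 64 <= #|layer C a| + 48 by rewrite e leq_add2l; apply: h.
by rewrite -[64]/(16 + 48) leq_add2r => ge; apply/eqP; rewrite eqn_leq le.
Qed.

Lemma last_enc m n (c : doobV m n.+1) : last 0 (enc c) = (c.2 ord_max : 'Z_4).
Proof. by rewrite -[c in LHS]remKK enc_addK last_rcons. Qed.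

Lemma search3_complete m n R (C : {set doobV m.+1 n.+1}) :
  [seq head 0 w | w <- R] = iota 0 16 -> layer C 0%R = dec m.+1 n R ->
  #|C| = 64 -> mind C (2 * m + n + 1) ->
  exists2 W, W \in search3 m n R & C = dec m.+1 n.+1 W.
Proof.
move=> hR CR cC mC; pose inf w := 16 * last 0 w + head 0 w.
have infE (c : doobV m.+1 n.+1) :
    inf (enc c) = 16 * (c.2 ord_max : 'Z_4) + encS (c.1 ord0).
  by rewrite /inf last_enc head_enc.
have [c _|c c' cC1 cC2|t [ht dt vt]] := cover (inf := inf) cC.
- rewrite infE; have := encS_lt (c.1 ord0); have := ltn_ord (c.2 ord_max : 'Z_4).
  by rewrite {2}/Zp_trunc /=; lia.
- rewrite !infE => e; have l1 := encS_lt (c.1 ord0); have l2 := encS_lt (c'.1 ord0).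
  have split16 a b h h' : h < 16 -> h' < 16 -> 16 * a + h = 16 * b + h' ->
    a = b /\ h = h' by lia.
  have [/val_inj e2 /encS_inj e1] := split16 _ _ _ _ l1 l2 e.
  (* Words with the same last coordinate lie in one layer, where the first coordinate determines the
     word. *)
  have mL := mind_layer (a := c.2 ord_max) mC.
  rewrite -[c]remKK -[c']remKK -e2; congr (addK _ _).
  apply: (head_inj mL); first by rewrite in_set remKK.
    by rewrite in_set e2 remKK.
  exact: e1.
have ut : uniq t by apply: (@map_uniq _ _ inf); rewrite ht iota_uniq.
exists (rev t); last by rewrite -dt; apply: eq_dec => w; rewrite mem_rev.
rewrite /rev; apply: mem_search => //; last exact/allP; last first.
  by rewrite addn1 in mC; apply: pairwise_mind ut dt vt mC.
apply: all2_dom ht _ => w wt.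
have vw : validw m.+1 n.+1 w := allP vt _ wt.
have wC : decW m.+1 n.+1 w \in C by rewrite -dt inE decWK.
move: (decWK vw) wC; set c := decW _ _ w => <- {}wC {vw wt}.
rewrite /dom3 infE; have l1 := encS_lt (c.1 ord0); case: ifP => hi.
  (* Positions below 16 are those with last coordinate 0, hence the words of R in the order of their
     first coordinates. *)
  have z16 a h : 16 * a + h < 16 -> a = 0 by lia.
  have c0 : c.2 ord_max = 0%R by apply: val_inj; apply: z16 hi.
  rewrite c0 muln0 add0n.
  have : remK c \in layer C 0%R by rewrite in_set -c0 remKK.
  rewrite CR inE => rR.
  have hr : head 0 (enc (remK c)) = encS (c.1 ord0) by rewrite head_enc.
  rewrite -[c in X in X \in _]remKK enc_addK c0 mem_seq1; apply/eqP.
  have iR : index (enc (remK c)) R < size R by rewrite index_mem.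
  have sR : size R = 16 by rewrite -(size_map (head 0)) hR size_iota.
  congr rcons; rewrite -hr -{2}(nth_index [::] rR) -(nth_map _ 0) //.
  by rewrite hR nth_iota ?add0n ?nth_index // -sR.
rewrite -[c in X in X \in _]remKK enc_addK.
have dm16 a h : h < 16 -> (16 * a + h) %% 16 = h /\ (16 * a + h) %/ 16 = a by lia.
have [-> ->] := dm16 (c.2 ord_max : 'Z_4) _ l1.
have := valid_enc (remK c); have := head_enc (remK c).
case: (enc (remK c)) => [|x v] /= hx vw; first by case/and3P: vw.
rewrite -rcons_cons -hx; apply: (map_f (fun v => rcons (x :: v) _)).
by apply: mem_words; case/and3P: vw => sz /= /andP[_ h1] h2; apply/and3P.
Qed.

(** The layer over 0 is carried to a representative by an equivalence of the whole code; the result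
    extends that representative, so the search lists it. *)
Lemma classify3 m n reps reps3 :
  (forall C : {set doobV m.+1 n}, #|C| = 16 -> mind C (2 * m + n + 1) ->
     has (code_equiv C) (map (dec m.+1 n) reps)) ->
  all (fun R => [seq head 0 w | w <- R] == iota 0 16) reps ->
  all (all (validw m.+1 n.+1)) reps3 -> classified3 m n reps reps3 ->
  forall C : {set doobV m.+1 n.+1}, #|C| = 64 -> mind C (2 * m + n + 1) ->
  has (code_equiv C) (map (dec m.+1 n.+1) reps3).
Proof.
move=> h2 /allP hr /allP vr /allP h3 C cC mC.
have /hasP[_ /mapP[R Rr ->] /code_equiv_layer[C' CC' C'R]] :=
  h2 _ (layer_card16 0%R cC mC) (mind_layer mC).
have [|W /(allP (h3 _ Rr)) Wr C'W] :=
  search3_complete (eqP (hr _ Rr)) C'R _ (mind_equiv CC' mC).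
  by rewrite (code_equiv_card CC').
have [W' /flattenP[_ /mapP[V Vr ->] W'V] e] := dec_wreach m.+1 n.+1 Wr.
apply/hasP; exists (dec m.+1 n.+1 V); first exact: map_f.
apply: code_equiv_trans CC' _; rewrite C'W e code_equiv_sym.
exact: relayers_equiv (vr _ Vr) W'V.
Qed.

(** * An invariant separating the classes *)

(* The pairs at distance 2 form two orbits of Aut(Sh): [r3] is the one where
   the two common neighbours are not adjacent, i.e. where 2 (u - v) = 0. *)
Definition r3 (u v : shV) : bool :=
  [&& u != v, ~~ sh_adj u v &
   ~~ [exists z, exists z',
         [&& sh_adj u z, sh_adj v z, sh_adj u z', sh_adj v z' & sh_adj z z']]].

Definition r3n (x y : nat) : bool :=
  [&& x != y, ~~ odd (x %/ 4 + y %/ 4) & ~~ odd (x %% 4 + y %% 4)].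

Lemma exists_sh (P : pred nat) : [exists u : shV, P (encS u)] = has P (iota 0 16).
Proof.
apply/existsP/hasP => [[u Pu]|[x]].
  by exists (encS u); rewrite ?mem_iota ?encS_lt.
by rewrite mem_iota => /= lt Px; exists (decS x); rewrite decSK.
Qed.

(** The graph-theoretic form of the relation gives its invariance under Aut(Sh), the arithmetic form
    its evaluation. *)
Lemma r3E u v : r3 u v = r3n (encS u) (encS v).
Proof.
have h : all (fun x => all (fun y => [&& x != y, ~~ adjn x y &
    ~~ has (fun z => has (fun z' =>
       [&& adjn x z, adjn y z, adjn x z', adjn y z' & adjn z z'])
       (iota 0 16)) (iota 0 16)] == r3n x y) (iota 0 16)) (iota 0 16).
  by vm_compute.
rewrite -(eqP (forall_sh2 h u v)) (inj_eq encS_inj) -sh_adjE.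
congr [&& _, _ & ~~ _]; rewrite -exists_sh; apply: eq_existsb => z.
rewrite -exists_sh; apply: eq_existsb => z'.
by rewrite -!sh_adjE.
Qed.

Lemma r3_aut (t : {perm shV}) u v : sh_aut t -> r3 (t u) (t v) = r3 u v.
Proof.
move=> /sh_autP ht; rewrite /r3 (inj_eq perm_inj) ht; congr [&& _, _ & ~~ _].
apply/existsP/existsP => -[z /existsP[z' hz]].
  exists (t^-1 z)%g; apply/existsP; exists (t^-1 z')%g.
  by rewrite -[z](permKV t) -[z'](permKV t) !ht in hz.
by exists (t z); apply/existsP; exists (t z'); rewrite !ht.
Qed.

Definition nr3 m n (c c' : doobV m n) : nat := \sum_(i < m) r3 (c.1 i) (c'.1 i).

Lemma nr3_code_map m n (t : {ffun 'I_m -> {perm shV}})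
    (s : {ffun 'I_n -> {perm kV}}) (pi : 'S_m) (rho : 'S_n) c c' :
  (forall i, sh_aut (t i)) ->
  nr3 (code_map t s pi rho c) (code_map t s pi rho c') = nr3 c c'.
Proof.
move=> ht; rewrite /nr3 [RHS](reindex_inj (@perm_inj _ pi)) /=.
by apply: eq_bigr => i _; rewrite !ffunE r3_aut.
Qed.

Definition nr3_pairs m n (C : {set doobV m n}) (v : nat) : nat :=
  \sum_(c in C) \sum_(c' in C) (nr3 c c' == v).

Lemma nr3_pairs_equiv m n (C C' : {set doobV m n}) v :
  code_equiv C C' -> nr3_pairs C v = nr3_pairs C' v.
Proof.
case/code_equivP=> t [s [p [r [ht ->]]]].
have inj : {in C &, injective (code_map t s p r)} by move=> c c' _ _ /code_map_inj.
rewrite /nr3_pairs big_imset //=; apply: eq_bigr => c _.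
by rewrite big_imset //=; apply: eq_bigr => c' _; rewrite nr3_code_map.
Qed.

Lemma sum_dec m n (F : seq nat -> nat) W : uniq W -> all (validw m n) W ->
  \sum_(c in dec m n W) F (enc c) = sumn [seq F w | w <- W].
Proof.
move=> uW vW; rewrite -big_enum /= -(big_map (@enc m n) xpredT F) /=.
by rewrite (perm_big _ (perm_enc_dec uW vW)) sumnE big_map.
Qed.

Definition nr3_pairsw (m : nat) (W : seq (seq nat)) (k : nat) : nat :=
  sumn [seq sumn [seq (sumn [seq (r3n (nth 0 w i) (nth 0 v i) : nat) | i <- iota 0 m]
                       == k : nat)
                 | v <- W] | w <- W].

Lemma nr3_pairs_dec m n W k : uniq W -> all (validw m n) W ->
  nr3_pairs (dec m n W) k = nr3_pairsw m W k.
Proof.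
move=> uW vW; rewrite /nr3_pairsw -(sum_dec _ uW vW).
apply: eq_bigr => c _; rewrite -(sum_dec _ uW vW); apply: eq_bigr => c' _.
congr (nat_of_bool (_ == _)).
transitivity (\sum_(0 <= i < m) (r3n (nth 0 (enc c) i) (nth 0 (enc c') i) : nat)).
  by rewrite big_mkord; apply: eq_bigr => i _; rewrite !nth_encS r3E.
by rewrite /index_iota subn0 sumnE big_map.
Qed.

Lemma dec_inequiv m n W W' k : uniq W -> all (validw m n) W ->
  uniq W' -> all (validw m n) W' -> nr3_pairsw m W k != nr3_pairsw m W' k ->
  ~~ code_equiv (dec m n W) (dec m n W').
Proof.
move=> u v u' v'; apply: contra => /(nr3_pairs_equiv k).
by rewrite !nr3_pairs_dec // => ->.
Qed.

(** * Representatives for k = 2 and k = 3 and the resulting counts *)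

Definition graph_code (cols : seq (seq nat)) : seq (seq nat) :=
  [seq [seq nth 0 c x | c <- iota 0 16 :: cols] | x <- iota 0 16].

(* Tables of maps on vertices encoded as 4 a + b, taken from the output of the
   search; [sh_map2] is the linear map sending (a, b) to (a + b, 3 a + 2 b). *)
Definition sh_map1 := [:: 0; 2; 8; 10; 7; 9; 15; 1; 14; 12; 6; 4; 11; 5; 3; 13].
Definition sh_map2 := [:: 0; 6; 8; 14; 7; 9; 15; 1; 10; 12; 2; 4; 13; 3; 5; 11].
Definition colour1 := [:: 0; 1; 0; 1; 3; 2; 3; 2; 0; 1; 0; 1; 2; 3; 2; 3].
Definition colour2 := [:: 0; 1; 0; 1; 3; 2; 3; 2; 1; 0; 1; 0; 2; 3; 2; 3].
Definition colour3 := [:: 0; 1; 2; 3; 1; 2; 3; 0; 2; 3; 0; 1; 3; 0; 1; 2].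
Definition colour5 := [:: 0; 1; 0; 1; 3; 2; 3; 2; 0; 1; 0; 1; 3; 2; 3; 2].
Definition colour4 := [:: 0; 1; 3; 2; 3; 2; 0; 1; 0; 1; 3; 2; 3; 2; 0; 1].

Definition reps20 := [seq graph_code c | c <- [:: [:: sh_map1]; [:: sh_map2]]].
Definition reps12 := [:: graph_code [:: colour2; colour3]].
Definition reps21 :=
  [seq graph_code c | c <- [:: [:: sh_map1; colour1]; [:: sh_map2; colour5]]].
Definition reps13 := [:: graph_code [:: colour2; colour3; colour4]].

Lemma classified20 : classified2 1 0 reps20.
Proof. by vm_compute. Qed.

Lemma classified12 : classified2 0 2 reps12.
Proof. by vm_compute. Qed.

Lemma classified21 : classified2 1 1 reps21.
Proof. by vm_compute. Qed.

Lemma classified13 : classified2 0 3 reps13.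
Proof. by vm_compute. Qed.

(** The representative is the first extension found. Were there none, the default empty list would
    fail the test in [reps3_mds]. *)
Definition first3 (m n : nat) (R : seq (seq nat)) : seq (seq nat) :=
  head [::] (search3 m n R).

Definition reps213 := [seq first3 1 0 R | R <- reps20].
Definition reps133 := [seq first3 0 2 R | R <- reps12].
(** The second code of [reps21] is the one extended; by [classified223], every extension of either
    code is this one with its layers renamed. *)
Definition reps223 := [:: first3 1 1 (nth [::] reps21 1)].

Lemma classified213 : classified3 1 0 reps20 reps213.
Proof. by vm_compute. Qed.

Lemma classified133 : classified3 0 2 reps12 reps133.
Proof. by vm_compute. Qed.

Lemma classified223 : classified3 1 1 reps21 reps223.
Proof. by vm_compute. Qed.

(** With no representatives nothing is reached, so the test succeeds only because the search finds
    no extension. *)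
Lemma classified143 : classified3 0 3 reps13 [::].
Proof. by vm_compute. Qed.

Lemma L_from_reps m n k reps : all (mdsw m n k) reps ->
  (forall C : {set doobV m n}, mds_code k C -> has (code_equiv C) (map (dec m n) reps)) ->
  pairwise (fun W W' => nr3_pairsw m W m != nr3_pairsw m W' m) reps ->
  L m n k = size reps.
Proof.
move=> /allP hm hc hp; rewrite -(size_map (dec m n)); apply: L_reps => //.
  by apply/allP => _ /mapP[W WW ->]; apply/mdsw_dec/hm.
rewrite pairwise_map; apply: (sub_in_pairwise (P := mem reps)) (allss reps) hp.
move=> W W' /hm/and5P[u v _ _ _] /hm/and5P[u' v' _ _ _] /=.
exact: dec_inequiv.
Qed.

Lemma L2_eq m n reps : all (mdsw m.+1 n 2) reps -> classified2 m n reps ->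
  2 * m.+1 + n - 2 + 1 = 2 * m + n + 1 ->
  pairwise (fun W W' => nr3_pairsw m.+1 W m.+1 != nr3_pairsw m.+1 W' m.+1) reps ->
  L m.+1 n 2 = size reps.
Proof.
move=> hm hc e; apply: L_from_reps => // C /mds_codeW[cC mC].
apply: classify2 hc _ _ _ => //; last by rewrite -e.
by apply: sub_all hm => W /and5P[].
Qed.

Lemma L3_eq m n reps reps3 :
  all (mdsw m.+1 n 2) reps -> classified2 m n reps ->
  all (fun R => [seq head 0 w | w <- R] == iota 0 16) reps ->
  all (mdsw m.+1 n.+1 3) reps3 -> classified3 m n reps reps3 ->
  pairwise (fun W W' => nr3_pairsw m.+1 W m.+1 != nr3_pairsw m.+1 W' m.+1) reps3 ->
  L m.+1 n.+1 3 = size reps3.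
Proof.
move=> hm hc hh hm3 hc3; apply: L_from_reps => // C /mds_codeW[cC mC].
apply: (classify3 _ hh _ hc3) => //.
- move=> C' cC' mC'; apply: classify2 hc _ _ _ => //.
  by apply: sub_all hm => W /and5P[].
- by apply: sub_all hm3 => W /and5P[].
by have <- : 2 * m.+1 + n.+1 - 3 + 1 = 2 * m + n + 1 by lia.
Qed.

Lemma reps2_mds : [&& all (mdsw 2 0 2) reps20, all (mdsw 1 2 2) reps12,
  all (mdsw 2 1 2) reps21 & all (mdsw 1 3 2) reps13].
Proof. by vm_compute. Qed.

Lemma reps3_mds : [&& all (mdsw 2 1 3) reps213, all (mdsw 1 3 3) reps133
  & all (mdsw 2 2 3) reps223].
Proof. by vm_compute. Qed.

Lemma L_2_0_2 : L 2 0 2 = 2.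
Proof.
have /and4P[h _ _ _] := reps2_mds.
by apply: (L2_eq h classified20).
Qed.

Lemma L_1_2_2 : L 1 2 2 = 1.
Proof.
have /and4P[_ h _ _] := reps2_mds.
by apply: (L2_eq h classified12).
Qed.

Lemma L_2_1_2 : L 2 1 2 = 2.
Proof.
have /and4P[_ _ h _] := reps2_mds.
by apply: (L2_eq h classified21).
Qed.

Lemma L_1_3_2 : L 1 3 2 = 1.
Proof.
have /and4P[_ _ _ h] := reps2_mds.
by apply: (L2_eq h classified13).
Qed.

Lemma L_2_1_3 : L 2 1 3 = 2.
Proof.
have /and4P[h _ _ _] := reps2_mds; have /and3P[h3 _ _] := reps3_mds.
apply: (L3_eq h classified20 _ h3 classified213); by vm_compute.
Qed.

Lemma L_1_3_3 : L 1 3 3 = 1.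
Proof.
have /and4P[_ h _ _] := reps2_mds; have /and3P[_ h3 _] := reps3_mds.
by apply: (L3_eq h classified12 _ h3 classified133).
Qed.

Lemma L_2_2_3 : L 2 2 3 = 1.
Proof.
have /and4P[_ _ h _] := reps2_mds; have /and3P[_ _ h3] := reps3_mds.
by apply: (L3_eq h classified21 _ h3 classified223).
Qed.

Lemma L_1_4_3 : L 1 4 3 = 0.
Proof.
have /and4P[_ _ _ h] := reps2_mds.
by apply: (L3_eq h classified13 _ _ classified143).
Qed.

(** * Codes with k = 1: four words at maximal distance *)

(** The deficits from the coordinatewise maxima 2 and 1 are nonnegative and add up to 0, so each of
    them vanishes. *)
Lemma max_dist m n (c c' : doobV m n) : 2 * m + n <= doob_dist c c' ->
  (forall i, gdist sh_adj (c.1 i) (c'.1 i) = 2) /\ (forall j, c.2 j != c'.2 j).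
Proof.
rewrite doob_distE => h.
have e1 : \sum_(i < m) gdist sh_adj (c.1 i) (c'.1 i)
    + \sum_(i < m) (2 - gdist sh_adj (c.1 i) (c'.1 i)) = 2 * m.
  rewrite -big_split /= (eq_bigr (fun=> 2)); last by move=> i _; rewrite subnKC ?gdist_sh_le2.
  by rewrite sum_nat_const card_ord mulnC.
have e2 : \sum_(j < n) gdist k_adj (c.2 j) (c'.2 j)
    + \sum_(j < n) (1 - gdist k_adj (c.2 j) (c'.2 j)) = n.
  rewrite -big_split /= (eq_bigr (fun=> 1)).
    by rewrite sum_nat_const card_ord muln1.
  by move=> i _; rewrite gdist_k; case: (_ != _).
have /andP[] : (\sum_(i < m) (2 - gdist sh_adj (c.1 i) (c'.1 i)) == 0)
  && (\sum_(j < n) (1 - gdist k_adj (c.2 j) (c'.2 j)) == 0) by lia.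
rewrite !sum_nat_eq0 => /forallP h1 /forallP h2; split=> [i|j].
  apply/eqP; rewrite eqn_leq gdist_sh_le2 /= -subn_eq0.
  exact: (implyP (h1 i)).
by have := h2 j; rewrite gdist_k; case: (_ != _).
Qed.

Definition pairs4 (T : Type) (r : rel T) (a b c d : T) : bool :=
  [&& r a b, r a c, r a d, r b c, r b d & r c d].

Lemma sub_pairs4 (T U : Type) (r : rel T) (s : rel U) (f : T -> U) a b c d :
  (forall x y, r x y -> s (f x) (f y)) ->
  pairs4 r a b c d -> pairs4 s (f a) (f b) (f c) (f d).
Proof.
move=> h; rewrite /pairs4.
by case/and5P=> /h -> /h -> /h -> /h -> /andP[/h -> /h ->].
Qed.

Definition farw (m n : nat) (c c' : doobV m n) : bool :=
  2 * m + n <= doob_dist c c'.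

Definition quad (m n : nat) (c0 c1 c2 c3 : doobV m n) : bool :=
  pairs4 (@farw m n) c0 c1 c2 c3.

Definition matching (r : rel nat) (x y z t : nat) : nat :=
  if r x y then if r x z then 0 else 1 else if r x z then 2 else 3.

(* [matching r3n] tells which of the three splittings of a 4-coclique into two
   pairs consists of pairs related by [r3n], or is 0 if all pairs are. *)
Definition base_quad (t k : nat) : nat :=
  nth 0 (nth [::] [:: [:: 0; 2; 8; 10]; [:: 0; 10; 7; 13];
                      [:: 0; 7; 10; 13]; [:: 0; 7; 13; 10]] t) k.

Definition farn (x y : nat) : bool := dsh x y == 2.

Definition type4 (u0 u1 u2 u3 : shV) : nat :=
  matching r3n (encS u0) (encS u1) (encS u2) (encS u3).

Lemma matching_lt4 r x y z t : matching r x y z t < 4.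
Proof. by rewrite /matching; do 2!case: ifP. Qed.

Definition far4 (u0 u1 u2 u3 : shV) : bool :=
  pairs4 (fun u v => gdist sh_adj u v == 2) u0 u1 u2 u3.

Lemma type4_aut (t : {perm shV}) u0 u1 u2 u3 : sh_aut t ->
  type4 (t u0) (t u1) (t u2) (t u3) = type4 u0 u1 u2 u3.
Proof. by move=> ht; rewrite /type4 /matching -!r3E !r3_aut. Qed.

Lemma gdist_aut (t : {perm shV}) u v : sh_aut t ->
  gdist sh_adj (t u) (t v) = gdist sh_adj u v.
Proof. by move=> /sh_autP ht; rewrite !gdist_shE (inj_eq perm_inj) ht. Qed.

(** A translation moves the first vertex to 0; a map in [stab0] then settles the other three, by
    inspection of all 4-cocliques through 0. *)
Lemma far4_base u0 u1 u2 u3 : far4 u0 u1 u2 u3 ->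
  exists2 t : {perm shV}, sh_aut t &
    [/\ encS (t u0) = base_quad (type4 u0 u1 u2 u3) 0,
        encS (t u1) = base_quad (type4 u0 u1 u2 u3) 1,
        encS (t u2) = base_quad (type4 u0 u1 u2 u3) 2 &
        encS (t u3) = base_quad (type4 u0 u1 u2 u3) 3].
Proof.
have h : all (fun x => all (fun y => all (fun z =>
    pairs4 farn 0 x y z ==>
    has (fun a => [&& nth 0 a 0 == base_quad (matching r3n 0 x y z) 0,
                      nth 0 a x == base_quad (matching r3n 0 x y z) 1,
                      nth 0 a y == base_quad (matching r3n 0 x y z) 2 &
                      nth 0 a z == base_quad (matching r3n 0 x y z) 3]) stab0)
  (iota 0 16)) (iota 0 16)) (iota 0 16) by vm_compute.
have hs : all autl stab0 by vm_compute.
have [t ht t0 far] := sh_aut_to0 u0.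
have far' : pairs4 farn (encS (t u0)) (encS (t u1)) (encS (t u2)) (encS (t u3)).
  apply: (sub_pairs4 (f := encS \o t)) far => u v.
  by rewrite /farn /= -gdist_sh gdist_aut.
have I v : encS v \in iota 0 16 by rewrite mem_iota encS_lt.
have := allP (allP (allP h _ (I (t u1))) _ (I (t u2))) _ (I (t u3)).
have E : matching r3n 0 (encS (t u1)) (encS (t u2)) (encS (t u3)) = type4 u0 u1 u2 u3.
  by rewrite -(type4_aut _ _ _ _ ht) /type4 t0.
rewrite E; rewrite t0 in far'; rewrite far' implyTb => /hasP[a aS].
move=> /and4P[/eqP e0 /eqP e1 /eqP e2 /eqP e3].
have [s hs' sE] := sh_aut_of_list (allP hs _ aS).
exists (t * s)%g; last by split; rewrite permM sE ?t0 ?e0 ?e1 ?e2 ?e3.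
apply/sh_autP => u v.
by rewrite !permM (sh_autP _ hs') (sh_autP _ ht).
Qed.

Lemma far4_aut u0 u1 u2 u3 v0 v1 v2 v3 : far4 u0 u1 u2 u3 -> far4 v0 v1 v2 v3 ->
  type4 u0 u1 u2 u3 = type4 v0 v1 v2 v3 ->
  exists t : {perm shV}, [&& sh_aut t, t u0 == v0, t u1 == v1, t u2 == v2 & t u3 == v3].
Proof.
move=> /far4_base[t ht [t0 t1 t2 t3]] /far4_base[s hs [s0 s1 s2 s3]] e.
have E u v : encS (t u) = encS (s v) -> ((t * s^-1)%g u == v).
  by move/encS_inj => tu; rewrite permM tu permK.
exists (t * s^-1)%g; rewrite !E ?t0 ?t1 ?t2 ?t3 ?s0 ?s1 ?s2 ?s3 ?e // !andbT.
apply/sh_autP => u v; rewrite !permM.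
by rewrite -(sh_autP _ hs) !permKV (sh_autP _ ht).
Qed.

(** The relation is invariant, so it can be read off the base quadruple; the two pairs of a
    splitting are always related together. *)
Lemma far4_r3 u0 u1 u2 u3 : far4 u0 u1 u2 u3 ->
  let p := type4 u0 u1 u2 u3 in
  [/\ r3 u0 u1 = (p \in [:: 0; 1]), r3 u2 u3 = (p \in [:: 0; 1]),
      r3 u0 u2 = (p \in [:: 0; 2]) & r3 u1 u3 = (p \in [:: 0; 2])] /\
  r3 u0 u3 = (p \in [:: 0; 3]) /\ r3 u1 u2 = (p \in [:: 0; 3]).
Proof.
move=> /far4_base[t ht] /=; have := matching_lt4 r3n (encS u0) (encS u1) (encS u2) (encS u3).
rewrite -/(type4 u0 u1 u2 u3); move: (type4 _ _ _ _) => p p4 [e0 e1 e2 e3].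
have E u v : r3 u v = r3n (encS (t u)) (encS (t v)) by rewrite -r3E r3_aut.
rewrite !E e0 e1 e2 e3.
by move: p4 {e0 e1 e2 e3}; do 4!(case: p => [//|p]).
Qed.

Lemma perm_extend (f g : 'I_4 -> 'Z_4) : injective f -> injective g ->
  exists s : {perm kV}, forall k, s (f k) = g k.
Proof.
move=> fI gI; have hI : injective (g \o (invF fI : 'Z_4 -> 'I_4)).
  exact: inj_comp gI (can_inj (f_invF fI)).
by exists (perm hI) => k; rewrite permE /= (invF_f fI).
Qed.

Lemma pairs4_uniq (T : eqType) (a b c d : T) :
  pairs4 (fun x y => x != y) a b c d = uniq [:: a; b; c; d].
Proof. by rewrite /pairs4 /= !inE !negb_or !andbT -!andbA. Qed.

Lemma pairs4_sym (T : eqType) (r : rel T) a b c d : symmetric r ->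
  pairs4 r a b c d ->
  {in [:: a; b; c; d] &, forall x y, x != y -> r x y}.
Proof.
move=> sym /and5P[ab ac ad bc /andP[bd cd]] x y; rewrite !inE.
by move=> /or4P[] /eqP -> /or4P[] /eqP -> //; rewrite ?eqxx // sym.
Qed.

Lemma doob_dist_sym m n (x y : doobV m n) : doob_dist x y = doob_dist y x.
Proof.
have h u v : gdist sh_adj u v = gdist sh_adj v u.
  rewrite !gdist_sh; apply/eqP.
  by apply: (@forall_sh2 (fun a b => dsh a b == dsh b a)); vm_compute.
rewrite !doob_distE; congr (_ + _); apply: eq_bigr => i _ //.
by rewrite !gdist_k eq_sym.
Qed.

Lemma farw_sym m n : symmetric (@farw m n).
Proof. by move=> x y; rewrite /farw doob_dist_sym. Qed.

Section Quads.
Variables m n : nat.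
Implicit Types c d : doobV m n.

Definition types c0 c1 c2 c3 : seq nat :=
  [seq type4 (c0.1 i) (c1.1 i) (c2.1 i) (c3.1 i) | i <- enum 'I_m].

Lemma size_types c0 c1 c2 c3 : size (types c0 c1 c2 c3) = m.
Proof. by rewrite size_map size_enum_ord. Qed.

Lemma types_lt4 c0 c1 c2 c3 : all (gtn 4) (types c0 c1 c2 c3).
Proof. by apply/allP => _ /mapP[i _ ->]; apply: matching_lt4. Qed.

Lemma quad_far4 c0 c1 c2 c3 i : quad c0 c1 c2 c3 ->
  far4 (c0.1 i) (c1.1 i) (c2.1 i) (c3.1 i).
Proof.
apply: (sub_pairs4 (f := fun c : doobV m n => c.1 i)) => c d.
by case/max_dist => /(_ i) ->.
Qed.

Lemma quad_uniq c0 c1 c2 c3 j : quad c0 c1 c2 c3 ->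
  uniq [:: c0.2 j; c1.2 j; c2.2 j; c3.2 j].
Proof.
move=> q; rewrite -pairs4_uniq.
apply: (sub_pairs4 (f := fun c : doobV m n => c.2 j)) q => c d.
by case/max_dist => _ /(_ j).
Qed.

(** Equal multisets of types give a permutation of the Sh-coordinates after which the types agree
    one by one, and [far4_aut] applies in each. In a K-coordinate the four words take all four
    colours, so matching the words defines a permutation. *)
Lemma quad_equiv c0 c1 c2 c3 d0 d1 d2 d3 :
  quad c0 c1 c2 c3 -> quad d0 d1 d2 d3 ->
  perm_eq (types d0 d1 d2 d3) (types c0 c1 c2 c3) ->
  code_equiv [set c0; c1; c2; c3] [set d0; d1; d2; d3].
Proof.
move=> qc qd pt.
pose tc := [tuple type4 (c0.1 i) (c1.1 i) (c2.1 i) (c3.1 i) | i < m].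
have /tuple_permP[p pE] : perm_eq (types d0 d1 d2 d3) tc by exact: pt.
have {}pE i : type4 (c0.1 (p i)) (c1.1 (p i)) (c2.1 (p i)) (c3.1 (p i)) =
    type4 (d0.1 i) (d1.1 i) (d2.1 i) (d3.1 i).
  have := congr1 (fun s => nth 0 s i) pE.
  rewrite (nth_map i) ?size_enum_ord // nth_ord_enum => ->.
  by rewrite (nth_map i) ?size_enum_ord // nth_ord_enum tnth_mktuple.
have exT i := far4_aut (quad_far4 (p i) qc) (quad_far4 i qd) (pE i).
have exS j : exists s : {perm kV},
    [&& s (c0.2 j) == d0.2 j, s (c1.2 j) == d1.2 j, s (c2.2 j) == d2.2 j
      & s (c3.2 j) == d3.2 j].
  pose f (k : 'I_4) : 'Z_4 := nth 0%R [:: c0.2 j; c1.2 j; c2.2 j; c3.2 j] k.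
  pose g (k : 'I_4) : 'Z_4 := nth 0%R [:: d0.2 j; d1.2 j; d2.2 j; d3.2 j] k.
  have fI : injective f.
    by move=> k l /eqP; rewrite nth_uniq ?(quad_uniq j qc) // => /eqP/val_inj.
  have gI : injective g.
    by move=> k l /eqP; rewrite nth_uniq ?(quad_uniq j qd) // => /eqP/val_inj.
  have [s sE] := perm_extend fI gI.
  exists s; apply/and4P; split; apply/eqP.
  - exact: (sE (Ordinal (isT : 0 < 4))).
  - exact: (sE (Ordinal (isT : 1 < 4))).
  - exact: (sE (Ordinal (isT : 2 < 4))).
  - exact: (sE (Ordinal (isT : 3 < 4))).
pose t := [ffun i => xchoose (exT i)]; pose s := [ffun j => xchoose (exS j)].
have tP i := and5P (xchooseP (exT i)); have sP j := and4P (xchooseP (exS j)).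
apply/code_equivP; exists t, s, p, 1%g; split=> [i|].
  by rewrite ffunE; case: (tP i).
rewrite !imsetU !imset_set1.
have e0 : code_map t s p 1 c0 = d0.
  rewrite [RHS]surjective_pairing; congr pair; apply/ffunP => i; rewrite !ffunE.
    by case: (tP i) => _ /eqP.
  by rewrite perm1; case: (sP i) => /eqP.
have e1 : code_map t s p 1 c1 = d1.
  rewrite [RHS]surjective_pairing; congr pair; apply/ffunP => i; rewrite !ffunE.
    by case: (tP i) => _ _ /eqP.
  by rewrite perm1; case: (sP i) => _ /eqP.
have e2 : code_map t s p 1 c2 = d2.
  rewrite [RHS]surjective_pairing; congr pair; apply/ffunP => i; rewrite !ffunE.
    by case: (tP i) => _ _ _ /eqP.
  by rewrite perm1; case: (sP i) => _ _ /eqP.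
have e3 : code_map t s p 1 c3 = d3.
  rewrite [RHS]surjective_pairing; congr pair; apply/ffunP => i; rewrite !ffunE.
    by case: (tP i) => _ _ _ _ /eqP.
  by rewrite perm1; case: (sP i) => _ _ _ /eqP.
by rewrite e0 e1 e2 e3.
Qed.

Hypothesis mn0 : 0 < m + n.

Lemma quad_neq c0 c1 c2 c3 : quad c0 c1 c2 c3 -> uniq [:: c0; c1; c2; c3].
Proof.
rewrite -pairs4_uniq; apply: (sub_pairs4 (f := id)) => c d.
apply: contraTneq => ->.
rewrite /farw doob_distE !big1 => [|i _|i _]; try exact: gdistxx.
by rewrite -ltnNge; lia.
Qed.

Lemma quad_of_mds (C : {set doobV m n}) : mds_code 1 C ->
  exists c0 c1 c2 c3, quad c0 c1 c2 c3 /\ C = [set c0; c1; c2; c3].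
Proof.
move=> /mds_codeW[]; rewrite cardE expn1 => cC mC.
(* By [mn0] the truncated subtraction is exact, so the required distance is the upper bound of
   [doob_dist_le]. *)
have e : 2 * m + n - 1 + 1 = 2 * m + n by lia.
rewrite e in mC.
have inC c : (c \in C) = (c \in enum C) by rewrite mem_enum.
have uC := enum_uniq C.
case: (enum C) cC inC uC => [|c0 [|c1 [|c2 [|c3 [|? ?]]]]] //= _ inC uC.
exists c0, c1, c2, c3; split; last first.
  by apply/setP => c; rewrite inC !inE !orbA.
move: uC; rewrite -[X in X -> _]/(is_true (uniq [:: c0; c1; c2; c3])).
have far c d : c \in [:: c0; c1; c2; c3] -> d \in [:: c0; c1; c2; c3] ->
  c != d -> farw c d by rewrite -!inC; apply: mC.
rewrite -pairs4_uniq /quad /pairs4.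
by case/and5P=> ? ? ? ? /andP[? ?]; rewrite !far // !inE eqxx ?orbT.
Qed.

Lemma mds_of_quad c0 c1 c2 c3 : quad c0 c1 c2 c3 ->
  mds_code 1 [set c0; c1; c2; c3].
Proof.
move=> q; have u := quad_neq q.
have e : 2 * m + n - 1 + 1 = 2 * m + n by lia.
have far c d : c \in [set c0; c1; c2; c3] -> d \in [set c0; c1; c2; c3] ->
    c != d -> 2 * m + n <= doob_dist c d.
  have inS x : (x \in [set c0; c1; c2; c3]) = (x \in [:: c0; c1; c2; c3]).
    by rewrite !inE !orbA.
  by rewrite !inS; apply: (pairs4_sym (@farw_sym m n) q).
rewrite /mds_code /has_code_dist e; apply/and3P; split.
- have -> : [set c0; c1; c2; c3] = [set x in [:: c0; c1; c2; c3]].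
    by apply/setP => x; rewrite !inE !orbA.
  by rewrite cardsE (card_uniqP u).
- have c01 : c0 != c1.
    by move: u => /= /andP[]; rewrite !inE !negb_or => /andP[].
  apply/existsP; exists c0; rewrite !inE eqxx /=.
  apply/existsP; exists c1; rewrite !inE eqxx orbT /= c01 eqn_leq doob_dist_le /=.
  by apply: far; rewrite // !inE eqxx ?orbT.
apply/forallP => c; apply/implyP => cC; apply/forallP => d; apply/implyP => dC.
by apply/implyP; apply: far.
Qed.

End Quads.

Lemma size_lt4 (s : seq nat) : all (gtn 4) s ->
  size s = count_mem 0 s + count_mem 1 s + count_mem 2 s + count_mem 3 s.
Proof.
elim: s => //= x s IH /andP[+ /IH ->]; case: x => [|[|[|[|x]]]] //= _; lia.
Qed.

Lemma perm_lt4 (s t : seq nat) : all (gtn 4) s -> all (gtn 4) t ->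
  size s = size t -> count_mem 1 s = count_mem 1 t ->
  count_mem 2 s = count_mem 2 t -> count_mem 3 s = count_mem 3 t -> perm_eq s t.
Proof.
move=> s4 t4 sz e1 e2 e3; have e0 : count_mem 0 s = count_mem 0 t.
  by move: sz; rewrite (size_lt4 s4) (size_lt4 t4) e1 e2 e3; lia.
have big x u : 3 < x -> all (gtn 4) u -> count_mem x u = 0.
  move=> hx /allP u4; apply/eqP; rewrite -leqn0 leqNgt -has_count -all_predC.
  by apply/allP => y /u4 /= hy; apply/eqP => yx; move: hy; rewrite yx; lia.
apply/allP => x _; apply/eqP.
by case: x => [|[|[|[|x]]]] //; rewrite !big.
Qed.

(** * Type counts as a complete invariant for k = 1 *)

Section TypeCounts.
Variables m n : nat.
Hypothesis mn0 : 0 < m + n.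
Implicit Types C : {set doobV m n}.

(** The counts depend on the order in which the four words are taken, so one code may satisfy this
    for several triples. *)
Definition has_counts C (k1 k2 k3 : nat) : Prop :=
  exists c0 c1 c2 c3 : doobV m n,
    [/\ quad c0 c1 c2 c3, C = [set c0; c1; c2; c3],
        count_mem 1 (types c0 c1 c2 c3) = k1,
        count_mem 2 (types c0 c1 c2 c3) = k2 &
        count_mem 3 (types c0 c1 c2 c3) = k3].

Lemma has_counts_mds C : mds_code 1 C ->
  exists k1 k2 k3, has_counts C k1 k2 k3.
Proof.
move=> /(quad_of_mds mn0)[c0 [c1 [c2 [c3 [q e]]]]].
by do 3!eexists; exists c0, c1, c2, c3; split.
Qed.

Lemma has_counts_equiv C C' k1 k2 k3 :
  has_counts C k1 k2 k3 -> has_counts C' k1 k2 k3 -> code_equiv C C'.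
Proof.
move=> [c0 [c1 [c2 [c3 [qc -> cn1 cn2 cn3]]]]] [d0 [d1 [d2 [d3 [qd -> dn1 dn2 dn3]]]]].
apply: quad_equiv => //; apply: perm_lt4; rewrite ?types_lt4 ?size_types //.
- by rewrite dn1 cn1.
- by rewrite dn2 cn2.
- by rewrite dn3 cn3.
Qed.

(** The type records whether the first word is related to the second and to the third; exchanging
    these two exchanges types 1 and 2. *)
Lemma has_counts_swap12 C k1 k2 k3 :
  has_counts C k1 k2 k3 -> has_counts C k2 k1 k3.
Proof.
move=> [c0 [c1 [c2 [c3 [qc -> cn1 cn2 cn3]]]]].
pose sw x := if x == 1 then 2 else if x == 2 then 1 else x.
have qc' : quad c0 c2 c1 c3.
  case/and5P: qc => h01 h02 h03 h12 /andP[h13 h23].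
  by rewrite /quad /pairs4 [farw c2 c1]farw_sym h02 h01 h03 h23 h13 h12.
have E : types c0 c2 c1 c3 = map sw (types c0 c1 c2 c3).
  rewrite -map_comp; apply: eq_map => i /=; rewrite /type4 /matching /sw.
  by do 2!case: ifP.
exists c0, c2, c1, c3; split=> //.
- by apply/setP => x; rewrite !inE -!orbA; do !bool_congr.
- rewrite E count_map -cn2; apply: eq_count => x /=; rewrite /sw.
  by case: x => [|[|[|[|x]]]].
- rewrite E count_map -cn1; apply: eq_count => x /=; rewrite /sw.
  by case: x => [|[|[|[|x]]]].
- rewrite E count_map -cn3; apply: eq_count => x /=; rewrite /sw.
  by case: x => [|[|[|[|x]]]].
Qed.

(** The new type involves the relation between the first and the last word, which [far4_r3] derives
    from the old type; types 2 and 3 are exchanged. *)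
Lemma has_counts_swap23 C k1 k2 k3 :
  has_counts C k1 k2 k3 -> has_counts C k1 k3 k2.
Proof.
move=> [c0 [c1 [c2 [c3 [qc -> cn1 cn2 cn3]]]]].
pose sw x := if x == 2 then 3 else if x == 3 then 2 else x.
have qc' : quad c0 c1 c3 c2.
  case/and5P: qc => h01 h02 h03 h12 /andP[h13 h23].
  by rewrite /quad /pairs4 [farw c3 c2]farw_sym h01 h03 h02 h13 h12 h23.
have E : types c0 c1 c3 c2 = map sw (types c0 c1 c2 c3).
  rewrite -map_comp; apply: eq_map => i /=.
  have := far4_r3 (quad_far4 i qc); set u := type4 _ _ _ _ => /= -[[r01 _ _ _] [r03 _]].
  have u4 : u < 4 := matching_lt4 _ _ _ _ _.
  rewrite /type4 /matching -!r3E r01 r03 /sw.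
  by move: u4; move: (u) => v; do 4!(case: v => [//|v]).
exists c0, c1, c3, c2; split=> //.
- by apply/setP => x; rewrite !inE -!orbA; do !bool_congr.
- rewrite E count_map -cn1; apply: eq_count => x /=; rewrite /sw.
  by case: x => [|[|[|[|x]]]].
- rewrite E count_map -cn3; apply: eq_count => x /=; rewrite /sw.
  by case: x => [|[|[|[|x]]]].
- rewrite E count_map -cn2; apply: eq_count => x /=; rewrite /sw.
  by case: x => [|[|[|[|x]]]].
Qed.

Lemma has_counts_sorted C : mds_code 1 C ->
  exists k1 k2 k3, has_counts C k1 k2 k3 /\ k1 <= k2 <= k3.
Proof.
move=> /has_counts_mds[a [b [c h]]].
have s12 k1 k2 k3 := @has_counts_swap12 C k1 k2 k3.
have s23 k1 k2 k3 := @has_counts_swap23 C k1 k2 k3.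
have [ab|ba] := leqP a b; have [bc|cb] := leqP b c; have [ac|ca] := leqP a c.
- by exists a, b, c; split; [exact: h|rewrite ab].
- by exists a, b, c; split; [exact: h|rewrite ab].
- by exists a, c, b; split; [exact: s23 h|rewrite ac (ltnW cb)].
- by exists c, a, b; split; [exact: s12 (s23 _ _ _ h)|rewrite ab (ltnW ca)].
- by exists b, a, c; split; [exact: s12 h|rewrite ac (ltnW ba)].
- by exists b, c, a; split; [exact: s23 (s12 _ _ _ h)|rewrite bc (ltnW ca)].
- exists c, b, a; split; first exact: s12 (s23 _ _ _ (s12 _ _ _ h)).
  by rewrite (ltnW ba) (ltnW cb).
- exists c, b, a; split; first exact: s12 (s23 _ _ _ (s12 _ _ _ h)).
  by rewrite (ltnW ba) (ltnW cb).
Qed.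

Lemma has_counts_le C k1 k2 k3 : has_counts C k1 k2 k3 -> k1 + k2 + k3 <= m.
Proof.
move=> [c0 [c1 [c2 [c3 [qc _ <- <- <-]]]]].
have := size_lt4 (types_lt4 c0 c1 c2 c3); rewrite size_types => e.
by rewrite [leqRHS]e; lia.
Qed.

Lemma r3_sym u v : r3 u v = r3 v u.
Proof. by rewrite !r3E /r3n eq_sym addnC [(encS u %% _ + _)]addnC. Qed.

Lemma nr3_sym (c d : doobV m n) : nr3 c d = nr3 d c.
Proof. by apply: eq_bigr => i _; rewrite r3_sym. Qed.

Lemma nr3_id (c : doobV m n) : nr3 c c = 0.
Proof. by apply: big1 => i _; rewrite r3E /r3n eqxx. Qed.

Lemma nr3_quad (c0 c1 c2 c3 : doobV m n) : quad c0 c1 c2 c3 ->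
  let cnt k := count_mem k (types c0 c1 c2 c3) in
  [/\ nr3 c0 c1 = cnt 0 + cnt 1, nr3 c2 c3 = cnt 0 + cnt 1,
      nr3 c0 c2 = cnt 0 + cnt 2 & nr3 c1 c3 = cnt 0 + cnt 2] /\
  nr3 c0 c3 = cnt 0 + cnt 3 /\ nr3 c1 c2 = cnt 0 + cnt 3.
Proof.
move=> q cnt; have F := fun i => far4_r3 (quad_far4 i q).
have E k (x y : doobV m n) : 0 < k ->
    (forall i, r3 (x.1 i) (y.1 i) =
       (type4 (c0.1 i) (c1.1 i) (c2.1 i) (c3.1 i) \in [:: 0; k])) ->
    nr3 x y = cnt 0 + cnt k.
  move=> k0 h; rewrite /cnt /types -count_predUI /= [X in _ = _ + X](_ : _ = 0).
    rewrite addn0 count_map -sum1_count big_mkcond big_enum /=.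
    by apply: eq_bigr => i _; rewrite h !inE /=; case: ifP.
  apply/eqP; rewrite -leqn0 leqNgt -has_count; apply/hasPn => x0 _ /=.
  by case: x0 => [|x0] //; rewrite negb_and orbC; case: k k0 {h}.
do !split; apply: E => // i; have [[? ? ? ?] [? ?]] := F i; done.
Qed.

(** Four ordered pairs are diagonal. Each of the three splittings yields four more, related exactly
    in the k0 coordinates of type 0 and in those of its own type. *)
Lemma nr3_pairs_counts C k1 k2 k3 v : has_counts C k1 k2 k3 ->
  let k0 := m - (k1 + k2 + k3) in
  nr3_pairs C v = 4 * (0 == v) + 4 * count_mem v [:: k0 + k1; k0 + k2; k0 + k3].
Proof.
move=> [c0 [c1 [c2 [c3 [qc -> cn1 cn2 cn3]]]]] k0.
have cn0 : count_mem 0 (types c0 c1 c2 c3) = k0.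
  have := size_lt4 (types_lt4 c0 c1 c2 c3); rewrite size_types /k0 cn1 cn2 cn3.
  by lia.
have := nr3_quad qc; rewrite /= cn0 cn1 cn2 cn3.
move=> [[e01 e23 e02 e13] [e03 e12]].
have u := quad_neq mn0 qc.
have sumE (F : doobV m n -> nat) :
    \sum_(c in [set c0; c1; c2; c3]) F c = F c0 + (F c1 + (F c2 + (F c3 + 0))).
  rewrite (eq_bigl (mem [:: c0; c1; c2; c3])); last by move=> c; rewrite !inE !orbA.
  by rewrite -(big_uniq _ u) !big_cons big_nil.
rewrite /nr3_pairs !sumE !nr3_id [nr3 c1 c0]nr3_sym [nr3 c2 c0]nr3_sym.
rewrite [nr3 c3 c0]nr3_sym [nr3 c2 c1]nr3_sym [nr3 c3 c1]nr3_sym [nr3 c3 c2]nr3_sym.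
rewrite e01 e02 e03 e12 e13 e23 /=; lia.
Qed.

(** The invariant determines the multiset of the numbers k0 + ki, hence their sorted list. They
    total m + 2 k0, so k0 is determined, and then each ki. *)
Lemma has_counts_inj C C' k1 k2 k3 l1 l2 l3 :
  has_counts C k1 k2 k3 -> has_counts C' l1 l2 l3 -> code_equiv C C' ->
  k1 <= k2 <= k3 -> l1 <= l2 <= l3 -> [/\ k1 = l1, k2 = l2 & k3 = l3].
Proof.
move=> hk hl CC' ks ls; have kle := has_counts_le hk; have lle := has_counts_le hl.
pose k0 := m - (k1 + k2 + k3); pose l0 := m - (l1 + l2 + l3).
have : [:: k0 + k1; k0 + k2; k0 + k3] = [:: l0 + l1; l0 + l2; l0 + l3].
  apply: (sorted_eq leq_trans anti_leq); rewrite /= ?andbT ?leq_add2l //.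
  apply/allP => v _; apply/eqP.
  have := nr3_pairs_equiv v CC'.
  rewrite (nr3_pairs_counts v hk) (nr3_pairs_counts v hl) -/k0 -/l0.
  by move/addnI => /eqP; rewrite eqn_pmul2l // => /eqP.
by rewrite /k0 /l0 => -[]; split; lia.
Qed.

Definition std_word (ts : seq nat) (k : nat) : doobV m n :=
  ([ffun i : 'I_m => decS (base_quad (nth 0 ts i) k)],
   [ffun j : 'I_n => (inZp k : 'Z_4)]).

Definition std_code (k1 k2 k3 : nat) : {set doobV m n} :=
  let ts := nseq k1 1 ++ nseq k2 2 ++ nseq k3 3 ++ nseq (m - (k1 + k2 + k3)) 0 in
  [set std_word ts 0; std_word ts 1; std_word ts 2; std_word ts 3].

Lemma std_code_counts k1 k2 k3 : k1 + k2 + k3 <= m ->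
  has_counts (std_code k1 k2 k3) k1 k2 k3.
Proof.
move=> le; rewrite /std_code; set ts := _ ++ _.
have ts4 x : x \in ts -> x < 4.
  by rewrite !mem_cat !mem_nseq => /or4P[] /andP[_ /eqP ->].
have sz : size ts = m by rewrite /ts !size_cat !size_nseq; lia.
have base : all (fun t => all (fun k => base_quad t k < 16) (iota 0 4)) (iota 0 4).
  by vm_compute.
have encB (i : 'I_m) k : k < 4 ->
    encS ((std_word ts k).1 i) = base_quad (nth 0 ts i) k.
  move=> k4; rewrite ffunE decSK //.
  have ti : nth 0 ts i \in iota 0 4 by rewrite mem_iota ts4 // mem_nth // sz.
  by apply: (allP (allP base _ ti)); rewrite mem_iota.
have tE : types (std_word ts 0) (std_word ts 1) (std_word ts 2) (std_word ts 3) = ts.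
  apply: (@eq_from_nth _ 0); first by rewrite size_types.
  rewrite size_types => i hi; rewrite (nth_map (Ordinal hi)) ?size_enum_ord //.
  rewrite (nth_ord_enum _ (Ordinal hi)) /type4 !encB //=.
  have := ts4 (nth 0 ts i); rewrite mem_nth ?sz // => /(_ isT).
  by move: (nth 0 ts i) => t; do 4!(case: t => [//|t]).
exists (std_word ts 0), (std_word ts 1), (std_word ts 2), (std_word ts 3).
split=> //; try by rewrite tE /ts !count_cat !count_nseq /= !mul0n !mul1n ?addn0 ?add0n.
have far k l : k < 4 -> l < 4 -> k != l -> farw (std_word ts k) (std_word ts l).
  move=> k4 l4 kl; rewrite /farw doob_distE; apply: leq_add.
    rewrite -{1}(card_ord m) mulnC -sum_nat_const; apply: leq_sum => i _.
    rewrite gdist_sh !encB //.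
    have h : all (fun t => all (fun k => all (fun l => (k == l) ||
      (2 <= dsh (base_quad t k) (base_quad t l))) (iota 0 4)) (iota 0 4)) (iota 0 4).
      by vm_compute.
    have ti : nth 0 ts i \in iota 0 4 by rewrite mem_iota ts4 // mem_nth // sz.
    have := allP (allP (allP h _ ti) k _) l; rewrite !mem_iota => /(_ k4 l4).
    by rewrite (negPf kl).
  rewrite -{1}(card_ord n) -[#|_|]muln1 -sum_nat_const; apply: leq_sum => j _.
  rewrite gdist_k !ffunE lt0b; apply: contra kl => /eqP/(congr1 val) /=.
  by rewrite !modn_small // => ->.
by rewrite /quad /pairs4 !far.
Qed.

End TypeCounts.

(** * Counting sorted triples *)

(* [triples_le m] lists the (a, (b, c)) with 3 a + 2 b + c <= m; the triple
   stands for the sorted type counts a <= a + b <= a + b + c. *)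
Fixpoint pairs_le (m : nat) : seq (nat * nat) :=
  [seq (0, c) | c <- iota 0 m.+1] ++
  (if m is m'.+2 then [seq (p.1.+1, p.2) | p <- pairs_le m'] else [::]).

Fixpoint triples_le (m : nat) : seq (nat * (nat * nat)) :=
  [seq (0, p) | p <- pairs_le m] ++
  (if m is m'.+3 then [seq (p.1.+1, p.2) | p <- triples_le m'] else [::]).

Lemma pairs_leE m : pairs_le m = [seq (0, c) | c <- iota 0 m.+1] ++
  (if m is m'.+2 then [seq (p.1.+1, p.2) | p <- pairs_le m'] else [::]).
Proof. by case: m. Qed.

Lemma triples_leE m : triples_le m = [seq (0, p) | p <- pairs_le m] ++
  (if m is m'.+3 then [seq (p.1.+1, p.2) | p <- triples_le m'] else [::]).
Proof. by case: m. Qed.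

Lemma mem_pairs_le m b c : ((b, c) \in pairs_le m) = (2 * b + c <= m).
Proof.
elim/ltn_ind: m b c => m IH b c.
have E0 k : ((b, c) \in [seq (0, c) | c <- iota 0 k.+1]) = (b == 0) && (c <= k).
  apply/mapP/andP => [[c']|[/eqP -> ck]]; last by exists c; rewrite ?mem_iota.
  by rewrite mem_iota => /= h [-> ->].
rewrite pairs_leE mem_cat E0; case: m IH => [|[|m]] IH; rewrite ?orbF.
- by case: b {E0} => //=; lia.
- by case: b {E0} => //=; lia.
case: b {E0} => [|b].
  rewrite [X in _ || X](_ : _ = false) ?orbF //.
  by apply/negbTE/negP => /mapP[p].
rewrite -[(b.+1, c)]/((fun p : nat * nat => (p.1.+1, p.2)) (b, c)).
by rewrite mem_map ?IH //; [rewrite /=; lia | move=> [? ?] [? ?] /= [-> ->]].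
Qed.

Lemma mem_triples_le m a b c :
  ((a, (b, c)) \in triples_le m) = (3 * a + 2 * b + c <= m).
Proof.
elim/ltn_ind: m a => m IH a.
have E0 k : ((a, (b, c)) \in [seq (0, p) | p <- pairs_le k]) = (a == 0) && (2 * b + c <= k).
  apply/mapP/andP => [[p]|[/eqP -> ck]]; last by exists (b, c); rewrite ?mem_pairs_le.
  by move=> h [-> pE]; rewrite -mem_pairs_le pE.
rewrite triples_leE mem_cat E0; case: m IH => [|[|[|m]]] IH; rewrite ?orbF.
- by case: a {E0} => //=; lia.
- by case: a {E0} => //=; lia.
- by case: a {E0} => //=; lia.
case: a {E0} => [|a].
  rewrite [X in _ || X](_ : _ = false) ?orbF //.
  by apply/negbTE/negP => /mapP[p].
rewrite -[(a.+1, _)]/((fun p : nat * (nat * nat) => (p.1.+1, p.2)) (a, (b, c))).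
rewrite mem_map; last by move=> [? ?] [? ?] /= [-> ->].
by rewrite IH /=; lia.
Qed.

Lemma uniq_pairs_le m : uniq (pairs_le m).
Proof.
elim/ltn_ind: m => m IH.
have U k : uniq [seq (0, c) | c <- iota 0 k].
  by rewrite map_inj_uniq ?iota_uniq // => ? ? [].
rewrite pairs_leE cat_uniq U; case: m IH => [|[|m]] IH //=.
rewrite map_inj_uniq ?IH // ?andbT; last by move=> [? ?] [? ?] /= [-> ->].
by apply/hasPn => _ /mapP[p _ ->]; apply/negP => /mapP[].
Qed.

Lemma uniq_triples_le m : uniq (triples_le m).
Proof.
elim/ltn_ind: m => m IH.
have U k : uniq [seq (0, p) | p <- pairs_le k].
  by rewrite map_inj_uniq ?uniq_pairs_le // => ? ? [].
rewrite triples_leE cat_uniq U; case: m IH => [|[|[|m]]] IH //=.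
rewrite map_inj_uniq; last by move=> [? ?] [? ?] /= [-> ->].
rewrite IH ?andbT; last by lia.
by apply/hasPn => _ /mapP[p _ ->]; apply/negP => /mapP[].
Qed.

(** The step from m to m + 2 adds the m + 3 pairs with first entry 0, and (m + 4)^2 - (m + 2)^2 = 4
    (m + 3). *)
Lemma size_pairs_le m : 4 * size (pairs_le m) + m %% 2 = (m + 2) ^ 2.
Proof.
elim/ltn_ind: m => -[|[|m]] IH //.
have {}IH := IH m (leqnSn _); rewrite pairs_leE size_cat !size_map size_iota.
by move: IH; rewrite -!mulnn; lia.
Qed.

(** This is the formula for k = 1 with denominators cleared by 72. The step from m to m + 3 adds the
    pairs for m + 3, keeps m mod 3 and flips m mod 2. *)
Lemma size_triples_le m : 72 * size (triples_le m) + 9 * (m %% 2) + 8 * (m %% 3) =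
  2 * m ^ 3 + 21 * m ^ 2 + 66 * m + 72.
Proof.
elim/ltn_ind: m => -[|[|[|m]]] IH //.
have {}IH := IH m (leqW (leqnSn _)); rewrite triples_leE size_cat !size_map.
have := size_pairs_le m.+3; move: IH.
have -> : m.+3 %% 3 = m %% 3 by lia.
have -> : m.+3 %% 2 = 1 - m %% 2 by lia.
have := ltn_pmod m (isT : 0 < 2); rewrite !expnS !expn0 !muln1.
move: (m %% 2) (m %% 3) (size _) (size _) => p q s t; lia.
Qed.

Lemma L1_eq m n : 0 < m + n -> L m n 1 = size (triples_le m).
Proof.
move=> mn0.
pose code (p : nat * (nat * nat)) :=
  std_code m n p.1 (p.1 + p.2.1) (p.1 + p.2.1 + p.2.2).
have codeP p : p \in triples_le m ->
    has_counts (code p) p.1 (p.1 + p.2.1) (p.1 + p.2.1 + p.2.2).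
  by case: p => a [b c]; rewrite mem_triples_le => h; apply: std_code_counts => /=; lia.
rewrite -(size_map code); apply: L_reps.
- apply/allP => _ /mapP[p /codeP[c0 [c1 [c2 [c3 [q -> _ _ _]]]]] ->].
  exact: mds_of_quad.
- rewrite pairwise_map.
  have := uniq_triples_le m; rewrite uniq_pairwise.
  apply: (sub_in_pairwise (P := mem (triples_le m)) _ (allss _)).
  move=> p q pT qT; apply: contra_neqN => e.
  have [] := has_counts_inj mn0 (codeP _ pT) (codeP _ qT) e.
  - by rewrite leq_addr leq_addr.
  - by rewrite leq_addr leq_addr.
  by case: p q {pT qT e} => [a [b c]] [a' [b' c']] /= -> /addnI -> /addnI ->.
move=> C /(has_counts_sorted mn0)[k1 [k2 [k3 [h /andP[h12 h23]]]]].
pose p := (k1, (k2 - k1, k3 - k2)).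
have pT : p \in triples_le m.
  by rewrite mem_triples_le; have := has_counts_le mn0 h; lia.
apply/hasP; exists (code p); first exact: map_f.
apply: has_counts_equiv h _; have := codeP p pT.
by rewrite /= !subnKC.
Qed.

(** * The Plotkin bound *)

Lemma sum_ord_le N (F : 'I_N -> nat) k : (forall i, F i <= k) ->
  \sum_i F i <= N * k.
Proof.
move=> h; apply: (@leq_trans (\sum_(i < N) k)); first exact: leq_sum.
by rewrite sum_nat_const card_ord.
Qed.

(** Summing the identity over A x A turns the right side into a sum of squares, one for the total of
    each h over A. *)
Lemma gram_sum_le (T : finType) (A : {set T}) (f : T -> T -> nat) (a b : nat)
    (chars : seq (T -> int)) :
  {in A &, forall x y, (Posz a - Posz (b * f x y) = \sum_(h <- chars) h x * h y)%R} ->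
  b * (\sum_(x in A) \sum_(y in A) f x y) <= a * #|A| ^ 2.
Proof.
move=> h; set S := \sum_(x in A) _.
have e : (Posz (a * #|A| ^ 2) - Posz (b * S) =
    \sum_(g <- chars) (\sum_(x in A) g x) ^+ 2)%R.
  have -> : Posz (a * #|A| ^ 2) = (\sum_(x in A) \sum_(y in A) Posz a)%R.
    by rewrite !sumr_const -mulrnA -mulnn -mulr_natr natz -PoszM.
  have -> : Posz (b * S) = (\sum_(x in A) \sum_(y in A) Posz (b * f x y))%R.
    rewrite -[LHS]natz natrM natr_sum mulr_sumr; apply: eq_bigr => x _.
    rewrite natr_sum mulr_sumr; apply: eq_bigr => y _.
    by rewrite -natrM natz.
  rewrite -sumrB.
  transitivity (\sum_(x in A) \sum_(y in A) \sum_(g <- chars) g x * g y)%R.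
    apply: eq_bigr => x xA; rewrite -sumrB; apply: eq_bigr => y yA.
    exact: h.
  transitivity (\sum_(x in A) \sum_(g <- chars) \sum_(y in A) g x * g y)%R.
    by apply: eq_bigr => x _; apply: exchange_big.
  rewrite exchange_big /=; apply: eq_bigr => g _.
  rewrite expr2 mulr_suml; apply: eq_bigr => x _.
  by rewrite mulr_sumr.
rewrite -lez_nat -Num.Theory.subr_ge0 e; apply: Num.Theory.sumr_ge0 => g _.
exact: Num.Theory.sqr_ge0.
Qed.

(* Real and imaginary parts of the characters of Z_4^2 spanning the eigenspace
   of the eigenvalue 2 of Sh: with d the distance in Sh, 3 - 2 d is a positive
   multiple of the projection onto it. *)
Definition cos4 (k : nat) : int := nth 0%R [:: 1; 0; -1; 0]%R (k %% 4).
Definition sin4 (k : nat) : int := nth 0%R [:: 0; 1; 0; -1]%R (k %% 4).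

Definition sh_chars : seq (nat -> int) :=
  [:: (fun x => cos4 (x %/ 4)); (fun x => sin4 (x %/ 4)); cos4; sin4;
      (fun x => cos4 (x %/ 4 + 3 * x)); (fun x => sin4 (x %/ 4 + 3 * x))].

(** The nonconstant rows of a Hadamard matrix of order 4: their products sum to 3 on the diagonal
    and to -1 off it, that is, to 3 - 4 d. *)
Definition k_chars : seq (nat -> int) :=
  [:: (fun x => nth 0%R [:: 1; 1; -1; -1]%R x);
      (fun x => nth 0%R [:: 1; -1; 1; -1]%R x);
      (fun x => nth 0%R [:: 1; -1; -1; 1]%R x)].

Lemma sum_gdist_sh (T : finType) (A : {set T}) (g : T -> shV) :
  2 * (\sum_(x in A) \sum_(y in A) gdist sh_adj (g x) (g y)) <= 3 * #|A| ^ 2.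
Proof.
apply: (gram_sum_le (chars := [seq (fun x => h (encS (g x))) | h <- sh_chars])).
move=> x y _ _; rewrite gdist_sh big_map; apply/eqP.
apply: (@forall_sh2 (fun u v => Posz 3 - Posz (2 * dsh u v) == \sum_(h <- sh_chars) h u * h v)%R).
(* The sum is replaced by a [foldr], which [vm_compute] can evaluate. *)
rewrite (@eq_all _ _ (fun u => all (fun v =>
  (Posz 3 - Posz (2 * dsh u v))%R == foldr (fun h z => (h u * h v + z)%R) 0%R sh_chars)
    (iota 0 16))); first by vm_compute.
move=> u; apply: eq_all => v; congr (_ == _).
by rewrite !big_cons big_nil.
Qed.

Lemma sum_gdist_k (T : finType) (A : {set T}) (g : T -> kV) :
  4 * (\sum_(x in A) \sum_(y in A) gdist k_adj (g x) (g y)) <= 3 * #|A| ^ 2.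
Proof.
apply: (gram_sum_le (f := fun x y => gdist k_adj (g x) (g y))
  (chars := [seq (fun x : T => h (nat_of_ord (g x : 'Z_4))) | h <- k_chars])).
move=> x y _ _; rewrite gdist_k big_map !big_cons big_nil.
by case: (g x) => [[|[|[|[|?]]]] ?] //; case: (g y) => [[|[|[|[|?]]]] ?].
Qed.

Lemma sum_doob_dist (m n : nat) (T : finType) (A : {set T}) (g : T -> doobV m n) :
  \sum_(x in A) \sum_(y in A) doob_dist (g x) (g y) =
  \sum_(i < m) \sum_(x in A) \sum_(y in A) gdist sh_adj ((g x).1 i) ((g y).1 i) +
  \sum_(j < n) \sum_(x in A) \sum_(y in A) gdist k_adj ((g x).2 j) ((g y).2 j).
Proof.
rewrite [X in _ = X + _]exchange_big [X in _ = _ + X]exchange_big /= -big_split.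
apply: eq_bigr => x _; rewrite [X in _ = X + _]exchange_big.
rewrite [X in _ = _ + X]exchange_big /= -big_split.
by apply: eq_bigr => y _; rewrite doob_distE.
Qed.

Lemma sum_doob_dist_le (m n : nat) (T : finType) (A : {set T}) (g : T -> doobV m n) :
  4 * (\sum_(x in A) \sum_(y in A) doob_dist (g x) (g y)) <=
  3 * (2 * m + n) * #|A| ^ 2.
Proof.
rewrite sum_doob_dist mulnDr.
set S1 := \sum_(i < m) _; set S2 := \sum_(j < n) _.
have h1 : 2 * S1 <= m * (3 * #|A| ^ 2).
  rewrite /S1 big_distrr /=; apply: sum_ord_le => i.
  exact: sum_gdist_sh.
have h2 : 4 * S2 <= n * (3 * #|A| ^ 2).
  rewrite /S2 big_distrr /=; apply: sum_ord_le => i.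
  exact: sum_gdist_k.
by move: (#|A| ^ 2) h1 h2 => q; nia.
Qed.

Lemma sum_mind (m n : nat) (C : {set doobV m n}) d : mind C d ->
  #|C| * (#|C| - 1) * d <= \sum_(c in C) \sum_(c' in C) doob_dist c c'.
Proof.
move=> mC; rewrite -mulnA -sum_nat_const; apply: leq_sum => c cC.
rewrite (bigD1 c cC) /=; apply: leq_trans (leq_addl _ _).
have -> : #|C| - 1 = #|C :\ c| by rewrite (cardsD1 c C) cC addKn.
rewrite -sum_nat_const (eq_bigl (fun c' => (c' \in C) && (c' != c))).
  by apply: leq_sum => c' /andP[c'C nc]; apply: mC; rewrite // eq_sym.
by move=> c'; rewrite !inE andbC.
Qed.

(** The lower and upper estimates of the sum of distances over ordered pairs are compared and
    divided by the size of C. *)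
Lemma plotkin (m n : nat) (C : {set doobV m n}) d : mind C d ->
  4 * d * (#|C| - 1) <= 3 * (2 * m + n) * #|C|.
Proof.
move=> /sum_mind h; have := sum_doob_dist_le C id.
have [->|C0] := posnP #|C|; first by rewrite sub0n !muln0.
move=> h2; rewrite -(leq_pmul2l C0); move: C0 h h2; rewrite -mulnn.
move: (\sum_(c in C) _) (2 * m + n) => S N.
by case: #|C| => [//|a] _; rewrite subn1 /=; lia.
Qed.

(** * Shortening, puncturing and restriction to an edge *)

Lemma pigeonhole (I : finType) (F : I -> nat) (s : nat) :
  0 < s -> \sum_i F i = s -> exists i, s <= #|I| * F i.
Proof.
move=> s0 e; apply/existsP; apply: contraTT isT => /existsPn h.
have I0 : 0 < #|I|.
  rewrite lt0n; apply/negP => /eqP I0; move: s0; rewrite -e big1 // => i _.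
  by have := card0_eq I0 i.
suff : #|I| * s < #|I| * s by rewrite ltnn.
rewrite -{1}e big_distrr /= -[X in _ < X]sum_nat_const.
have [i0 _] := card_gt0P I0.
rewrite (bigD1 i0) //= [X in _ < X](bigD1 i0) //= -addSn; apply: leq_add.
  by rewrite ltnNge h.
by apply: leq_sum => i _; rewrite ltnW // ltnNge h.
Qed.

Lemma card_fibres (T I : finType) (C : {set T}) (f : T -> I) :
  \sum_i #|[set c in C | f c == i]| = #|C|.
Proof.
rewrite -sum1_card (partition_big f xpredT) //=; apply: eq_bigr => i _.
by rewrite -sum1_card; apply: eq_bigl => c; rewrite inE.
Qed.

Lemma shortenK m n (C : {set doobV m n.+1}) d : 0 < #|C| -> mind C d ->
  exists2 C' : {set doobV m n}, mind C' d & #|C| <= 4 * #|C'|.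
Proof.
move=> C0 mC; have [a] := pigeonhole C0 (esym (card_layers C)).
by rewrite card_ord => h; exists (layer C a) => //; apply: mind_layer.
Qed.

Lemma fibreS m n (C : {set doobV m.+1 n}) d x : mind C d ->
  exists2 C' : {set doobV m n}, mind C' d &
    #|C'| = #|[set c in C | c.1 ord0 == x]|.
Proof.
move=> mC; set A := [set c in C | _].
have hA c : c \in A -> c \in C /\ c.1 ord0 = x.
  by rewrite inE => /andP[cC /eqP].
have inj : {in A &, injective (@remS m n)}.
  move=> c c' /hA[_ e] /hA[_ e'] er.
  by rewrite -(remSK c) -(remSK c') e e' er.
exists [set remS c | c in A]; last by rewrite card_in_imset.
move=> _ _ /imsetP[c cA ->] /imsetP[c' cA' ->] ne.
have [cC e] := hA _ cA; have [cC' e'] := hA _ cA'.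
have := mC _ _ cC cC'; rewrite doob_distS e e' gdistxx add0n; apply.
by apply: contra_neq ne => ->.
Qed.

Lemma shortenS m n (C : {set doobV m.+1 n}) d : 0 < #|C| -> mind C d ->
  exists2 C' : {set doobV m n}, mind C' d & #|C| <= 16 * #|C'|.
Proof.
move=> C0 mC.
have [x] := pigeonhole C0 (card_fibres C (fun c : doobV m.+1 n => c.1 ord0)).
have [C' mC' <-] := fibreS x mC.
by rewrite card_prod !card_ord => h; exists C'.
Qed.

(** Deleting a K-coordinate lowers a distance by at most 1; distances stay positive, so no two words
    merge. *)
Lemma puncture m n (C : {set doobV m n.+1}) d : mind C d.+2 ->
  exists2 C' : {set doobV m n}, mind C' d.+1 & #|C'| = #|C|.
Proof.
move=> mC.
have dist c c' : c \in C -> c' \in C -> c != c' -> d < doob_dist (remK c) (remK c').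
  move=> cC cC' ne; have := mC _ _ cC cC' ne; rewrite doob_distK.
  by case: (_ != _); rewrite ?addn1 ?addn0 //; apply: ltnW.
have inj : {in C &, injective (@remK m n)}.
  move=> c c' cC cC' e; apply/eqP; apply: contraT => /(dist _ _ cC cC').
  by rewrite e /doob_dist gdistxx.
exists [set remK c | c in C]; last by rewrite card_in_imset.
move=> _ _ /imsetP[c cC ->] /imsetP[c' cC' ->] ne; apply: dist => //.
by apply: contra_neq ne => ->.
Qed.

(* The words whose first coordinate lies on a given edge of the Shrikhande
   graph contribute less than average in that coordinate. *)
Lemma edge_bound m (C : {set doobV m.+1 0}) d : 0 < #|C| -> mind C d ->
  exists a, [/\ 0 < a, #|C| <= 8 * a & 2 * d * (a - 1) <= (3 * m + 1) * a].
Proof.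
(* The numbers 2 k and 2 k + 1 encode vertices with difference 01, so the eight values of [f] name
   the edges of a perfect matching of Sh. *)
move=> C0 mC; pose f (c : doobV m.+1 0) : 'I_8 := inord (encS (c.1 ord0) %/ 2).
have [k] := pigeonhole C0 (card_fibres C f); rewrite card_ord.
set A := [set c in C | _] => hA.
have AC : A \subset C by apply/subsetP => c; rewrite inE => /andP[].
have A0 : 0 < #|A| by move: (leq_trans C0 hA); rewrite muln_gt0.
exists #|A|; split=> //.
have fE c : c \in A -> encS (c.1 ord0) %/ 2 = k.
  rewrite inE => /andP[_ /eqP <-]; rewrite /f inordK //.
  by have := encS_lt (c.1 ord0); lia.
(* On one edge 1 - 2 d is a product of signs, which bounds the average by 1/2, against 3/2 for
   arbitrary words. *)
have h0 : 2 * (\sum_(c in A) \sum_(c' in A) gdist sh_adj (c.1 ord0) (c'.1 ord0)) <= 1 * #|A| ^ 2.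
  apply: (gram_sum_le (chars :=
    [:: fun c : doobV m.+1 0 => if odd (encS (c.1 ord0)) then 1 else -1]%R)).
  move=> c c' /fE ck /fE ck'; rewrite big_cons big_nil gdist_sh; apply/eqP.
  have : encS (c.1 ord0) %/ 2 == encS (c'.1 ord0) %/ 2 by rewrite ck ck'.
  apply/implyP; apply: (@forall_sh2 (fun x y => (x %/ 2 == y %/ 2) ==>
   (Posz 1 - Posz (2 * dsh x y) == (if odd x then 1 else -1) * (if odd y then 1 else -1) + 0)%R)).
  by vm_compute.
have h1 := sum_doob_dist_le A (@remS m 0).
have h2 := sum_mind (mind_sub AC mC).
have e : \sum_(c in A) \sum_(c' in A) doob_dist c c' =
    \sum_(c in A) \sum_(c' in A) gdist sh_adj (c.1 ord0) (c'.1 ord0) +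
    \sum_(c in A) \sum_(c' in A) doob_dist (remS c) (remS c').
  rewrite -big_split; apply: eq_bigr => c _; rewrite -big_split.
  by apply: eq_bigr => c' _; rewrite doob_distS.
rewrite e in h2; rewrite -(leq_pmul2l A0).
move: h0 h1 h2; move: (\sum_(c in A) _) (\sum_(c in A) _) => S1 S2.
rewrite -!mulnn; move: #|A| => a h0 h1 h2.
by case: a h0 h1 h2 => [//|a]; rewrite subn1 /=; lia.
Qed.

(** * The packing bound *)

Lemma doob_dist_triangle m n (x y z : doobV m n) :
  doob_dist x z <= doob_dist x y + doob_dist y z.
Proof.
rewrite !doob_distE addnACA -!big_split /=; apply: leq_add; apply: leq_sum => i _.
  rewrite !gdist_sh.
  have h : all (fun b => all (fun a => all (fun c => dsh a c <= dsh a b + dsh b c)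
    (iota 0 16)) (iota 0 16)) (iota 0 16) by vm_compute.
  have := allP (forall_sh2 h (y.1 i) (x.1 i)) (encS (z.1 i)); apply.
  by rewrite mem_iota encS_lt.
rewrite !gdist_k; have [->|_] := eqVneq (x.2 i) (y.2 i); first exact: leq_addl.
by case: (_ != _).
Qed.

Lemma doob_dist_refl m n (x : doobV m n) : doob_dist x x = 0.
Proof. by rewrite doob_distE !big1 // => i _; apply: gdistxx. Qed.

Definition sh_nb (u : shV) (k : nat) : shV :=
  decS (nth 0 [seq y <- iota 0 16 | adjn (encS u) y] k).

Definition k_nb (a : kV) (k : nat) : kV :=
  inZp (nth 0 [seq y <- iota 0 4 | y != nat_of_ord (a : 'Z_4)] k) : 'Z_4.

Lemma sh_nb_adj u (k : 'I_6) : sh_adj u (sh_nb u k).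
Proof.
have h : all (fun x => all (fun k => let y := nth 0 [seq y <- iota 0 16 | adjn x y] k in
   (y < 16) && adjn x y) (iota 0 6)) (iota 0 16) by vm_compute.
have /andP[lt a] := allP (forall_sh h u) k (etrans (mem_iota 0 6 k) (ltn_ord k)).
by rewrite sh_adjE decSK.
Qed.

Lemma sh_nb_inj u : injective (fun k : 'I_6 => sh_nb u k).
Proof.
have h : all (fun x => all (fun k => all (fun l =>
   (nth 0 [seq y <- iota 0 16 | adjn x y] k < 16) &&
   ((nth 0 [seq y <- iota 0 16 | adjn x y] k == nth 0 [seq y <- iota 0 16 | adjn x y] l)
    ==> (k == l))) (iota 0 6)) (iota 0 6)) (iota 0 16) by vm_compute.
move=> k l /(congr1 encS).
have I (i : 'I_6) : val i \in iota 0 6 by rewrite mem_iota ltn_ord.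
have /andP[ltk /implyP e] := allP (allP (forall_sh h u) _ (I k)) _ (I l).
have /andP[ltl _] := allP (allP (forall_sh h u) _ (I l)) _ (I l).
by rewrite /sh_nb (decSK ltk) (decSK ltl) => /eqP/e/eqP/val_inj.
Qed.

Lemma k_nb_neq a (k : 'I_3) : k_nb a k != a.
Proof. by case: a => [[|[|[|[|?]]]] ?] //; case: k => [[|[|[|?]]] ?]. Qed.

Lemma k_nb_inj a : injective (fun k : 'I_3 => k_nb a k).
Proof.
move=> k l e; apply/eqP; move: e => /eqP; apply/implyP.
by case: a => [[|[|[|[|?]]]] ?] //; case: k => [[|[|[|?]]] ?] //; case: l => [[|[|[|?]]] ?].
Qed.

Lemma sh_adj_neq u v : sh_adj u v -> v != u.
Proof.
apply: contraTneq => ->; rewrite sh_adjE.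
by apply: (@forall_sh (fun x => ~~ adjn x x)); vm_compute.
Qed.

Section Packing.
Variables m n : nat.

(** The index t parametrises the ball of radius 1: [None] is the centre, and the rest are six
    neighbours per Sh-coordinate and three per K-coordinate. *)
Definition move_word (c : doobV m n) (t : option ('I_m * 'I_6 + 'I_n * 'I_3)) : doobV m n :=
  match t with
  | None => c
  | Some (inl ik) =>
      ([ffun i => if i == ik.1 then sh_nb (c.1 i) ik.2 else c.1 i], c.2)
  | Some (inr jk) =>
      (c.1, [ffun j => if j == jk.1 then k_nb (c.2 j) jk.2 else c.2 j])
  end.

Lemma sum_single N (F : 'I_N -> nat) i : (forall j, j != i -> F j = 0) ->
  \sum_j F j = F i.
Proof. by move=> h; rewrite (bigD1 i) //= big1 ?addn0. Qed.

Lemma move_word_dist c t : doob_dist c (move_word c t) <= 1.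
Proof.
case: t => [[[i k]|[j k]]|]; last by rewrite doob_dist_refl.
  rewrite doob_distE [X in _ + X]big1 ?addn0 => [|j _]; last exact: gdistxx.
  rewrite (sum_single (i := i)) => [|j ji].
    by rewrite ffunE eqxx gdist_shE sh_nb_adj; case: ifP.
  by rewrite ffunE (negPf ji) gdistxx.
rewrite doob_distE [X in X + _]big1 ?add0n => [|i _]; last exact: gdistxx.
rewrite (sum_single (i := j)) => [|i ij]; first by rewrite gdist_k leq_b1.
by rewrite ffunE (negPf ij) gdistxx.
Qed.

Lemma move_word_inj c : injective (move_word c).
Proof.
have nbS u (k : 'I_6) : sh_nb u k <> u by apply/eqP/sh_adj_neq/sh_nb_adj.
have nbK a (k : 'I_3) : k_nb a k <> a by apply/eqP/k_nb_neq.
case=> [[[i k]|[j k]]|] [[[i' k']|[j' k']]|] //= e.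
- have /ffunP/(_ i) := congr1 fst e; rewrite !ffunE eqxx.
  by case: eqP => [<- /sh_nb_inj ->//|_ /nbS].
- by have /ffunP/(_ i) := congr1 fst e; rewrite ffunE eqxx => /nbS.
- by have /ffunP/(_ i) := congr1 fst e; rewrite ffunE eqxx => /nbS.
- by have /ffunP/(_ i') := congr1 fst e; rewrite ffunE eqxx => /esym/nbS.
- have /ffunP/(_ j) := congr1 snd e; rewrite !ffunE eqxx.
  by case: eqP => [<- /k_nb_inj ->//|_ /nbK].
- by have /ffunP/(_ j) := congr1 snd e; rewrite ffunE eqxx => /nbK.
- by have /ffunP/(_ i') := congr1 fst e; rewrite ffunE eqxx => /esym/nbS.
- by have /ffunP/(_ j') := congr1 snd e; rewrite ffunE eqxx => /esym/nbK.
Qed.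

(** Balls of radius 1 around words at distance at least 3 are disjoint by the triangle inequality,
    and each has 1 + 6 m + 3 n vertices. *)
Lemma packing (C : {set doobV m n}) : mind C 3 ->
  #|C| * (1 + 3 * (2 * m + n)) <= 4 ^ (2 * m + n).
Proof.
move=> mC; pose D := setX C [set: option ('I_m * 'I_6 + 'I_n * 'I_3)].
have inj : {in D &, injective (fun p => move_word p.1 p.2)}.
  move=> [c t] [c' t']; rewrite !in_setX => /andP[cC _] /andP[cC' _] /= e.
  have cc' : c = c'.
    apply/eqP; apply: contraT => /(mC _ _ cC cC'); rewrite leqNgt ltnS.
    rewrite (leq_trans (doob_dist_triangle c (move_word c t) c')) //.
    rewrite -[2]/(1 + 1); apply: leq_add; first exact: move_word_dist.
    by rewrite e doob_dist_sym move_word_dist.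
  by move: e; rewrite cc' => /move_word_inj ->.
have cV : #|doobV m n| = 4 ^ (2 * m + n).
  by rewrite card_prod !card_ffun card_prod !card_ord expnD expnM.
rewrite -cV; apply: leq_trans (max_card (mem [set move_word p.1 p.2 | p in D])).
rewrite card_in_imset // cardsX cardsT card_option card_sum !card_prod !card_ord.
by rewrite leq_mul2l; apply/orP; right; lia.
Qed.

End Packing.

(** * Exhaustive search in D(3, 0) *)

(* In D(3, 0) each first coordinate x occurs in exactly four words of a code
   with d = 4 and 64 words; listing them by increasing second coordinate makes
   the search visit every such block once. *)
Definition block_ok (y z : seq nat) : bool :=
  if nth 0 z 1 < nth 0 y 1 then 3 < wdist 3 y z else false.

Definition fibre_words (x : nat) : seq (seq nat) := [seq x :: w | w <- words 2 0].

(** Blocks of four words are added over one first coordinate at a time. Running out of coordinates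
    means that an extension exists, hence [false] there. *)
Fixpoint no_extension (xs : seq nat) (s : seq (seq nat)) : bool :=
  if xs is x :: xs' then
    let cand := [seq w <- fibre_words x | allb (fun v => 3 < wdist 3 w v) s] in
    allb (fun b => no_extension xs' (b ++ s)) (search block_ok (nseq 4 cand) [::])
  else false.

(** Words over adjacent first coordinates must be at distance at least 3 in the other two. The
    blocks over 0 and five of its neighbours already turn out incompatible. *)
Lemma no_code_3_0_search :
  allb (no_extension [:: 1; 5; 4; 15; 3])
    (search block_ok ([:: [:: 0; 0; 0]] :: nseq 3 (fibre_words 0)) [::]).
Proof. by vm_compute. Qed.

Lemma translate_to0 m (C : {set doobV m 0}) : 0 < #|C| ->
  exists2 C', code_equiv C C' & exists2 c, c \in C' & enc c = nseq m 0.
Proof.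
case/card_gt0P=> c0 c0C.
have exT (i : 'I_m) : exists t : {perm shV}, sh_aut t && (encS (t (c0.1 i)) == 0).
  by have [t h1 h2] := sh_aut_to0 (c0.1 i); exists t; rewrite h1 h2.
pose t := [ffun i => xchoose (exT i)].
have tP i := andP (xchooseP (exT i)).
exists [set code_map t [ffun=> 1%g] 1 1 c | c in C].
  apply/code_equivP; exists t, [ffun=> 1%g], 1%g, 1%g; split=> // i.
  by rewrite ffunE; case: (tP i).
exists (code_map t [ffun=> 1%g] 1 1 c0); first exact: imset_f.
apply: (@eq_from_nth _ 0); rewrite size_enc addn0 ?size_nseq // => k hk.
rewrite nth_nseq hk (nth_encS _ (Ordinal hk)) !ffunE perm1.
by case: (tP (Ordinal hk)) => _ /eqP.
Qed.

Section ThreeShrikhande.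
Variable C : {set doobV 3 0}.
Hypotheses (mC : mind C 4) (cC : 64 <= #|C|).

Let F (x : nat) := [set c in C | c.1 ord0 == decS x].
Let key (w : seq nat) := nth 0 w 1.
Let fw (x : nat) := sort (fun w v => key w <= key v) [seq enc c | c <- enum (F x)].

(** A fibre is a code with d = 4 in D(2, 0), where the Plotkin bound allows four words; 16 fibres
    holding at least 64 words force equality. *)
Lemma fibre_card4 x : x < 16 -> #|F x| = 4.
Proof.
move=> x16.
have le (u : shV) : #|[set c in C | c.1 ord0 == u]| <= 4.
  have [C' mC' <-] := fibreS u mC; have := plotkin mC'.
  by move: #|C'| => a; lia.
apply/eqP; rewrite eqn_leq le /=.
have := cC; rewrite -(card_fibres C (fun c : doobV 3 0 => c.1 ord0)).
rewrite (bigD1 (decS x)) //= -/(F x).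
have : \sum_(u : shV | u != decS x) #|[set c in C | c.1 ord0 == u]| <=
    \sum_(u : shV | u != decS x) 4 by apply: leq_sum => u _; apply: le.
rewrite sum_nat_const (cardC1 (decS x)) card_prod !card_ord => h1 h2.
have {h1} : 64 <= #|F x| + 60 by apply: leq_trans h2 _; rewrite leq_add2l; apply: h1.
by rewrite -[64]/(4 + 60) leq_add2r.
Qed.

Lemma mem_fw x w : x < 16 -> w \in fw x ->
  exists c, [/\ c \in C, enc c = w, encS (c.1 ord0) = x & head 0 w = x].
Proof.
move=> x16; rewrite mem_sort => /mapP[c]; rewrite mem_enum inE => /andP[cC' /eqP e] ->.
by exists c; rewrite head_enc e decSK.
Qed.

Lemma size_fw x : x < 16 -> size (fw x) = 4.
Proof. by move=> x16; rewrite size_sort size_map -cardE fibre_card4. Qed.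

(** Words agreeing in the first two coordinates are at distance at most 2. *)
Lemma key_inj x : x < 16 -> {in fw x &, injective key}.
Proof.
move=> x16 w v /(mem_fw x16)[c [c1 <- c2 _]] /(mem_fw x16)[c' [c'1 <- c'2 _]].
have i1 : 1 < 3 by [].
rewrite /key !(nth_encS _ (Ordinal i1)) => /encS_inj e.
congr enc; apply/eqP; apply: contraT => /(mC c1 c'1).
rewrite doob_distS (_ : c.1 ord0 = c'.1 ord0) ?gdistxx ?add0n; last first.
  by apply: encS_inj; rewrite c2 c'2.
rewrite doob_distS !ffunE (_ : lift ord0 ord0 = Ordinal i1); last exact: val_inj.
rewrite e gdistxx add0n leqNgt ltnS.
by rewrite (leq_trans (doob_dist_le _ _)).
Qed.

Lemma far_words w v : w \in [seq enc c | c in C] -> v \in [seq enc c | c in C] ->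
  w != v -> 3 < wdist 3 w v.
Proof.
case/imageP=> c c1 -> /imageP[c' c'1 ->] ne; rewrite -doob_dist_enc; apply: mC => //.
by apply: contra_neq ne => ->.
Qed.

Lemma fw_sub x w : x < 16 -> w \in fw x -> w \in [seq enc c | c in C].
Proof. by move=> x16 /(mem_fw x16)[c [c1 <- _ _]]; apply: image_f. Qed.

Lemma pairwise_fw x : x < 16 -> pairwise (fun a b => block_ok b a) (fw x).
Proof.
move=> x16; have ut : uniq (fw x).
  by rewrite sort_uniq map_inj_uniq ?enum_uniq //; apply: enc_inj.
have st : pairwise (fun w v => key w <= key v) (fw x).
  rewrite -sorted_pairwise; last by move=> ? ? ?; apply: leq_trans.
  by apply: sort_sorted => ? ?; apply: leq_total.
rewrite uniq_pairwise in ut.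
have := pairwise_relI (fun w v => key w <= key v) (fun w v => w != v) (fw x).
rewrite st ut /=; apply: (sub_in_pairwise (P := mem (fw x))) (allss _).
move=> w v wf vf /= /andP[le ne]; rewrite /block_ok -/(key w) -/(key v).
rewrite ltn_neqAle le andbT (_ : key w != key v); last first.
  by apply: contra_neq ne => /(key_inj x16 wf vf).
by apply: far_words; rewrite ?(fw_sub x16) // eq_sym.
Qed.

Lemma mem_fibre_words x w : x < 16 -> w \in fw x -> w \in fibre_words x.
Proof.
move=> x16 /(mem_fw x16)[c [_ <- _ hx]].
have := valid_enc c; case: (enc c) hx => [|y v] /= hx vw; first by case/and3P: vw.
rewrite hx; apply/map_f/mem_words.
by case/and3P: vw => sz /= /andP[_ h1] h2; apply/and3P.
Qed.

(** The sorted fibre of C over the next coordinate is itself one of the blocks tried, so the search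
    can always continue. The condition on heads keeps the new words distinct from those of s. *)
Lemma no_extension_sound xs s : uniq xs -> all (gtn 16) xs ->
  {subset s <= [seq enc c | c in C]} -> {in s, forall v, head 0 v \notin xs} ->
  ~~ no_extension xs s.
Proof.
elim: xs s => [//|x xs IH] s; rewrite cons_uniq => /andP[xx ux].
move=> /andP[x16 lx] sC hs; pose cand :=
  [seq w <- fibre_words x | allb (fun v => 3 < wdist 3 w v) s].
have -> : no_extension (x :: xs) s =
    allb (fun b => no_extension xs (b ++ s)) (search block_ok (nseq 4 cand) [::]) by [].
rewrite allbE; apply/negP => /allP/(_ (rev (fw x))) h.
suff /h : rev (fw x) \in search block_ok (nseq 4 cand) [::].
  apply/negP; apply: IH => // v; rewrite mem_cat mem_rev => /orP[vf|vs].
  - exact: fw_sub vf.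
  - exact: sC.
  - by have [c [_ _ _ ->]] := mem_fw x16 vf.
  by have := hs v vs; rewrite inE negb_or => /andP[].
rewrite /rev; apply: mem_search; [|exact: pairwise_fw|exact/allP].
rewrite -(size_fw x16); have : {subset fw x <= fw x} by [].
move: {1 3 4}(fw x) => t; elim: t => [//|w t IHt] sub.
apply/andP; split; last by apply: IHt => v vt; apply: sub; rewrite inE vt orbT.
have wf : w \in fw x by apply: sub; rewrite mem_head.
rewrite mem_filter (mem_fibre_words x16 wf) andbT allbE; apply/allP => v vs.
apply: far_words (fw_sub x16 wf) (sC v vs) _.
have [c [_ _ _ hw]] := mem_fw x16 wf.
by apply: contraTneq (hs v vs) => <-; rewrite hw mem_head.
Qed.

Lemma no_zero_code c : c \in C -> enc c != nseq 3 0.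
Proof.
move=> c1; apply/negP => /eqP e0.
have z16 : 0 < 16 by [].
have zf : nseq 3 0 \in fw 0.
  rewrite mem_sort -e0; apply: map_f; rewrite mem_enum inE c1 /=; apply/eqP.
  by rewrite -[LHS]encSK -head_enc e0.
have := no_code_3_0_search; rewrite allbE => /allP/(_ (rev (fw 0))) h.
suff /h : rev (fw 0) \in search block_ok ([:: nseq 3 0] :: nseq 3 (fibre_words 0)) [::].
  apply/negP; apply: no_extension_sound => // v; rewrite mem_rev => vf.
    exact: fw_sub vf.
  by have [x [_ _ _ ->]] := mem_fw z16 vf.
rewrite /rev; apply: mem_search; [|exact: pairwise_fw|exact/allP].
have := size_fw z16; have := @mem_fibre_words 0 _ z16.
have := @key_inj 0 z16; have := pairwise_fw z16.
move: (fibre_words 0) => W; case: (fw 0) zf => [//|w t] zf pw ki mf [st].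
(* The zero word has the least possible second coordinate, so it comes first in the sorted fibre. *)
have w0 : w \in [:: nseq 3 0].
  rewrite mem_seq1; move: zf; rewrite inE eq_sym => /orP[//|zt].
  have /andP[/allP/(_ _ zt) ok _] := pw.
  have {ok} : block_ok (nseq 3 0) w := ok.
  by rewrite /block_ok [nth 0 (nseq 3 0) 1]/= ltn0.
have {}mf : {in t, forall v, v \in W}.
  by move=> v vt; apply: mf; rewrite inE vt orbT.
case: t st mf {zf pw ki} => [|a [|b [|c' [|]]]] // _ mf.
by apply/and5P; split=> //; apply: mf; rewrite !inE eqxx ?orbT.
Qed.

End ThreeShrikhande.

Lemma no_code_3_0 (C : {set doobV 3 0}) : mind C 4 -> #|C| < 64.
Proof.
move=> mC; rewrite ltnNge; apply/negP => cC.
have [|C' CC' [c cC' ce]] := @translate_to0 3 C; first by apply: leq_trans cC.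
have := no_zero_code (mind_equiv CC' mC) _ cC'.
by rewrite (code_equiv_card CC') ce eqxx => /(_ cC).
Qed.

(** * Nonexistence results and the theorem *)

(** Induction on k with d fixed. For k = 2 the Plotkin bound gives 60 d <= 48 (d + 1), so d <= 4.
    Shortening a K-coordinate lowers k by 1; if there is none, shortening an Sh-coordinate lowers k
    by 2, except for k = 3, where [edge_bound] is used. *)
Lemma no_code_d5 k m n d (C : {set doobV m n}) : mind C d ->
  d + k = 2 * m + n + 1 -> 1 < k -> 4 < d -> #|C| < 4 ^ k.
Proof.
move=> + + + d4; elim/ltn_ind: k m n C => k IH m n C mC e k2.
rewrite ltnNge; apply/negP => cC.
have C0 : 0 < #|C| by apply: leq_trans cC; rewrite expn_gt0.
have [k2'|k3] : k = 2 \/ 2 < k by lia.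
  move: cC (plotkin mC); rewrite k2' -[4 ^ 2]/16.
  have -> : 2 * m + n = d + 1 by lia.
  by move: #|C| => a; nia.
case: n C mC e cC C0 => [|n] C mC e cC C0; last first.
  have [C' mC' le] := shortenK C0 mC.
  have k1 : k.-1 < k by lia.
  have e1 : d + k.-1 = 2 * m + n + 1 by lia.
  have k12 : 1 < k.-1 by lia.
  have := IH _ k1 _ _ C' mC' e1 k12.
  have e4 : 4 ^ k = 4 * 4 ^ k.-1 by rewrite -expnS prednK //; lia.
  by move: cC le; rewrite e4; lia.
case: m C mC e cC C0 => [|m] C mC e cC C0; first by lia.
have [k3'|k4] : k = 3 \/ 3 < k by lia.
  have [a [a0 h1 h2]] := edge_bound C0 mC.
  have a8 : 8 <= a by move: (leq_trans cC h1); rewrite k3' -[4 ^ 3]/64; lia.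
  (* The bound becomes 4 m (a - 1) <= (3 m + 1) a, which with a >= 8 forces m <= 2, against 2 m = d
     > 4. *)
  have ed : d = 2 * m by lia.
  rewrite ed in h2; nia.
have [C' mC' le] := shortenS C0 mC.
have k1 : k.-2 < k by lia.
have e1 : d + k.-2 = 2 * m + 0 + 1 by lia.
have k12 : 1 < k.-2 by lia.
have := IH _ k1 _ _ C' mC' e1 k12.
have e4 : 4 ^ k = 16 * 4 ^ k.-2.
  by rewrite -[16]/(4 ^ 2) -expnD; congr (_ ^ _); lia.
by move: cC le; rewrite e4; lia.
Qed.

(** A ball of radius 1 has at least 19 vertices, while a code of the excluded size leaves at most 16
    per word. *)
Lemma no_code_d3 m n (C : {set doobV m n}) : mind C 3 -> 5 < 2 * m + n ->
  #|C| < 4 ^ (2 * m + n - 2).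
Proof.
move=> mC N5; have := packing mC.
have -> : 4 ^ (2 * m + n) = 4 ^ (2 * m + n - 2) * 16.
  by rewrite -[16]/(4 ^ 2) -expnD; congr (_ ^ _); lia.
have : 0 < 4 ^ (2 * m + n - 2) by rewrite expn_gt0.
move: (4 ^ _) => q q0 h; rewrite ltnNge; apply/negP => le.
have : q * 19 <= q * 16 by apply: leq_trans h; apply: leq_mul => //; lia.
by rewrite leq_pmul2l.
Qed.

(** With a K-coordinate, puncturing reduces to d = 3. Without one, shortening Sh-coordinates reduces
    to D(3, 0). *)
Lemma no_code_d4 m n (C : {set doobV m n}) : mind C 4 ->
  6 < 2 * m + n \/ 2 < m /\ n = 0 -> #|C| < 4 ^ (2 * m + n - 3).
Proof.
case: n C => [|n] C mC hN.
  have {hN} : 2 < m by lia.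
  elim: m C mC => [//|m IH] C mC m2.
  have [m3|m3] : m = 2 \/ 2 < m by lia.
    by move: C mC; rewrite m3 => C; apply: no_code_3_0.
  rewrite ltnNge; apply/negP => cC.
  have C0 : 0 < #|C| by apply: leq_trans cC; rewrite expn_gt0.
  have [C' mC' le] := shortenS C0 mC.
  have := IH C' mC' m3; have e4 : 4 ^ (2 * m.+1 + 0 - 3) = 16 * 4 ^ (2 * m + 0 - 3).
    by rewrite -[16]/(4 ^ 2) -expnD; congr (_ ^ _); lia.
  by move: cC le; rewrite e4; lia.
have [C' mC' <-] := puncture mC.
have -> : 2 * m + n.+1 - 3 = 2 * m + n - 2 by lia.
by apply: no_code_d3 => //; lia.
Qed.

Lemma no_mds m n k : (forall C : {set doobV m n},
    mind C (2 * m + n - k + 1) -> #|C| < 4 ^ k) ->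
  forall C : {set doobV m n}, ~~ mds_code k C.
Proof. by move=> h C; apply/negP => /mds_codeW[e /h]; rewrite e ltnn. Qed.

Lemma no_mds_large m n d : 6 < 2 * m + n -> 2 < d -> d < 2 * m + n ->
  forall C : {set doobV m n}, ~~ mds_code (2 * m + n - d + 1) C.
Proof.
move=> N6 d2 dN; apply: no_mds => C.
have -> : 2 * m + n - (2 * m + n - d + 1) + 1 = d by lia.
have [d3|[d4|d5]] : d = 3 \/ d = 4 \/ 4 < d by lia.
- rewrite d3 => /no_code_d3; have -> : 2 * m + n - 3 + 1 = 2 * m + n - 2 by lia.
  by apply; lia.
- rewrite d4 => /no_code_d4; have -> : 2 * m + n - 4 + 1 = 2 * m + n - 3 by lia.
  by apply; lia.
by move=> /no_code_d5; apply; lia.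
Qed.

Theorem theorem1 :
  (forall m n : nat, 0 < m + n ->
     ((L m n 1)%:R =
        m%:R ^+ 3 / 36 + 7 * m%:R ^+ 2 / 24 + 11 * m%:R / 12 + 1
        - (m %% 2)%N%:R / 8 - (m %% 3)%N%:R / 9 :> rat)%R) /\
  ([seq L mn.1 mn.2 (2 * mn.1 + mn.2 - 2) |
      mn <- [:: (2, 0); (1, 2); (2, 1); (1, 3); (2, 2); (1, 4); (3, 0)]] =
      [:: 2; 1; 2; 1; 0; 0; 0] /\
   [seq L mn.1 mn.2 (2 * mn.1 + mn.2 - 3) |
      mn <- [:: (2, 0); (1, 2); (2, 1); (1, 3); (2, 2); (1, 4); (3, 0)]] =
      [:: 4; 2; 2; 1; 1; 0; 0]) /\
  (forall m n : nat, 2 * m + n = 6 -> L m n 2 = 0) /\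
  (forall m n d : nat, 6 < 2 * m + n -> 2 < d -> d < 2 * m + n ->
     L m n (2 * m + n - d + 1) = 0 /\
     ~ (exists C : {set doobV m n}, mds_code (2 * m + n - d + 1) C)).
Proof.
have L4 m n : 2 * m + n = 6 -> L m n 4 = 0.
  move=> N6; apply/L_eq0/no_mds => C; have -> : 2 * m + n - 4 + 1 = 3 by lia.
  by move=> /no_code_d3; rewrite N6; apply.
split=> [m n mn0|].
  rewrite (L1_eq mn0).
  have h : ((72 * size (triples_le m) + 9 * (m %% 2) + 8 * (m %% 3))%N%:R =
      (2 * m ^ 3 + 21 * m ^ 2 + 66 * m + 72)%N%:R :> rat)%R by rewrite size_triples_le.
  by rewrite !(natrD, natrM, natrX) in h; lra.
split; [split|split].
(* For d = 3 the seven values of k are 2, 2, 3, 3, 4, 4, 4. *)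
- rewrite /= L_2_0_2 L_1_2_2 L_2_1_3 L_1_3_3.
  by rewrite !L4.
(* For d = 4 they are 1, 1, 2, 2, 3, 3, 3. *)
- rewrite /= L_2_1_2 L_1_3_2 L_2_2_3 L_1_4_3 !L1_eq // (@L_eq0 3 0 3) //.
  by apply: no_mds => C; apply: no_code_3_0.
(* Here 2 m + n = 6 and k = 2 give d = 5. *)
- move=> m n N6; apply/L_eq0/no_mds => C mC.
  by apply: no_code_d5 mC _ _ _; lia.
move=> m n d N6 d2 dN; have h := no_mds_large N6 d2 dN.
split; first exact: L_eq0.
by case=> C; apply/negP/h.
Qed.
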